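(* Let $f\in H^2(\mathbb{D})$. Let the double reduced remainders $\tilde f_k$ and parameters $a_k\in\mathbb{D}$ be defined by $\tilde f_1=f$ and, for $k=1,2,\dots$, $$|\langle \tilde f_k,e_{a_k}\rangle|=\max\{|\langle \tilde f_k,e_a\rangle| : a\in\mathbb{D}\},\qquad \tilde f_{k+1}(z)=\frac{\tilde f_k(z)-\langle \tilde f_k,e_{a_k}\rangle e_{a_k}(z)}{\left(\frac{z-a_k}{1-\overline{a}_kz}\right)^2}.$$ Then $$f=\sum_{k=1}^\infty\langle \tilde f_k,e_{a_k}\rangle\tilde B_k$$ with convergence in the $H^2(\mathbb{D})$ norm, where $\{\tilde B_k\}_{k=1}^\infty$ is the double Takenaka–Malmquist system generated by the selected $a_k$'s.
   Context: $\mathbb{D}$ is the open unit disc and $H^2(\mathbb{D})$ is the Hardy space of functions $f(z)=\sum_{k\ge0}c_kz^k$ with $\|f\|^2=\sum_{k\ge 0}|c_k|^2<\infty$, with inner product $\langle f,g\rangle=\frac1{2\pi}\int_0^{2\pi}f(e^{it})\overline{g(e^{it})}\,dt$ of the boundary values. For $a\in\mathbb{D}$, $e_a(z)=\frac{\sqrt{1-|a|^2}}{1-\overline{a}z}$ is the normalized Szegő kernel, so that $\langle f,e_a\rangle=\sqrt{1-|a|^2}\,f(a)$. The maxima above are attained in $\mathbb{D}$, and for maximizing $a_k$ each $\tilde f_{k+1}$ is (after removing the singularity at $a_k$) in $H^2(\mathbb{D})$. The double Takenaka–Malmquist system generated by $a_1,a_2,\dots$ is $\tilde B_1=e_{a_1}$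 and $\tilde B_k(z)=e_{a_k}(z)\prod_{l=1}^{k-1}\left(\frac{z-a_l}{1-\overline{a}_lz}\right)^2$ for $k\ge2$; it is an orthonormal system in $H^2(\mathbb{D})$. *)

(* Defs.v *)
From HB Require Import structures.
From mathcomp Require Import all_boot all_order all_algebra complex.
From mathcomp Require Import all_classical all_reals all_analysis.

Set Implicit Arguments.
Unset Strict Implicit.
Unset Printing Implicit Defensive.

Import Order.TTheory GRing.Theory Num.Theory.
Import numFieldNormedType.Exports.
Import ComplexField.

Local Open Scope classical_set_scope.
Local Open Scope complex_scope.
Local Open Scope ring_scope.

(* The topology of [R[i]] is that of the modulus. *)
HB.instance Definition _ (R : realType) :=
  NormedModule.copy R[i] R[i]^o.

Section HardySpace.
Variable R : realType.
Local Notation C := R[i].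
Local Notation normc := (@Normc.normc R).

Definition open_disc : set C := [set z | `|z| < 1].

Definition square_summable (c : nat -> C) : Prop :=
  (\sum_(0 <= k <oo) (normc (c k) ^+ 2)%:E < +oo)%E.

Definition power_series_on_disc (f : C -> C) (c : nat -> C) : Prop :=
  forall z, open_disc z -> series (fun k => c k * z ^+ k) @ \oo --> f z.

(* Elements of the Hardy space are total functions on the complex plane; only
   their values in the open disc are ever looked at. *)
Definition hardy2 (f : C -> C) : Prop :=
  exists2 c, square_summable c & power_series_on_disc f c.

Definition taylor_coefs (f : C -> C) : nat -> C :=
  get [set c | power_series_on_disc f c].

(* Meaningful only for [f] in [hardy2]. *)
Definition hardy2_norm (f : C -> C) : R :=
  Num.sqrt (fine (\sum_(0 <= k <oo) (normc (taylor_coefs f k) ^+ 2)%:E)%E).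

Definition hardy2_cvg (u : nat -> C -> C) (f : C -> C) : Prop :=
  (forall n, hardy2 (fun z => f z - u n z)) /\
  hardy2_norm (fun z => f z - u n z) @[n --> \oo] --> (0 : R).

Definition expit (t : R) : C := cos t +i* sin t.

Definition circle : set R := `[0, 2 * pi]%classic.

(* [F t] is the boundary value at [e^(it)], in the mean-square sense: the
   dilates [t |-> f (r e^(it))] converge to [F] in L^2 as [r] tends to 1. *)
Definition is_boundary_value (f : C -> C) (F : R -> C) : Prop :=
  [/\ measurable_fun circle (fun t => complex.Re (F t)),
      measurable_fun circle (fun t => complex.Im (F t)) &
      (\int[lebesgue_measure]_(t in circle)
         (normc (f (r%:C * expit t) - F t) ^+ 2)%:E)%E @[r --> (1 : R)^'-]
        --> 0%E].

(* Two boundary values of the same function agree almost everywhere, so the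
   integrals below do not depend on the one that is picked. *)
Definition boundary_value (f : C -> C) : R -> C :=
  get [set F | is_boundary_value f F].

Definition circle_integral (h : R -> C) : C :=
  Rintegral lebesgue_measure circle (fun t => complex.Re (h t)) +i*
  Rintegral lebesgue_measure circle (fun t => complex.Im (h t)).

Definition hardy2_dot (f g : C -> C) : C :=
  (2 * pi)^-1%:C *
  circle_integral (fun t => boundary_value f t * (boundary_value g t)^*).

Definition szego (a : C) : C -> C :=
  fun z => (Num.sqrt (1 - normc a ^+ 2))%:C / (1 - a^* * z).

Definition mobius (a : C) : C -> C := fun z => (z - a) / (1 - a^* * z).

Definition double_TM (a : nat -> C) (k : nat) : C -> C :=
  fun z => szego (a k) z * \prod_(0 <= l < k) mobius (a l) z ^+ 2.

Definition double_reduction (f : C -> C) (a : C) : C -> C :=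
  fun z => (f z - hardy2_dot f (szego a) * szego a z) / mobius a z ^+ 2.

(* The singularity at [a] is filled in by the limit. *)
Definition next_remainder (f : C -> C) (a : C) : C -> C :=
  fun z => if z == a then lim (double_reduction f a w @[w --> a^'])
           else double_reduction f a z.

Fixpoint double_remainder (f : C -> C) (a : nat -> C) (k : nat) : C -> C :=
  if k is k'.+1 then next_remainder (double_remainder f a k') (a k') else f.

Definition maximal_selection (f : C -> C) (a : C) : Prop :=
  open_disc a /\
  forall b, open_disc b ->
    `|hardy2_dot f (szego b)| <= `|hardy2_dot f (szego a)|.

End HardySpace.

(* Main.v *)
Require Import Defs.
From mathcomp Require Import all_boot all_order all_algebra complex.
From mathcomp Require Import all_classical all_reals all_analysis.
From mathcomp Require Import measurable_realfun ring lra.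
Import Order.TTheory GRing.Theory Num.Theory.
Import numFieldNormedType.Exports.
Import ComplexField.
Set Implicit Arguments.
Unset Strict Implicit.
Unset Printing Implicit Defensive.
Local Open Scope classical_set_scope.
Local Open Scope complex_scope.
Local Open Scope ring_scope.

(** Write [f_k] for the [k]-th remainder, [l_k] for its pairing with the kernel
    at [a_k] and [m_k] for the Moebius factor of [a_k], so that
    [f_k = l_k e_(a_k) + m_k^2 f_(k+1)].

    Why the expansion converges.  The pairing with the kernel at [a] is the
    value at [a] times [sqrt (1 - |a|^2)] ([hardy2_dot_szego]).  Hence
    [f_k - l_k e_(a_k)] vanishes at [a_k], and the first-order condition at the
    maximum makes its derivative vanish there as well ([peval_max_deriv]); so
    [f_(k+1)] is again in the Hardy space ([next_remainderP]).  Multiplication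
    by a Moebius factor is an isometry ([sqnorm_mobius_mul]) and functions
    vanishing at [a] are orthogonal to the kernel at [a] ([sqnorm_szegoD]).
    Therefore [|f_k|^2 = |l_k|^2 + |f_(k+1)|^2], and the [m]-th error of the
    expansion is [h_m = m_0^2 ... m_(m-1)^2 f_m], of the same norm as [f_m].

    It remains to see that these norms tend to 0.  The [|l_k|^2] are summable,
    so [l_m] tends to 0.  By maximality, [|f_m z| sqrt (1 - |z|^2) <= |l_m|] at
    every point [z] of the disc, and [|h_m z| <= |f_m z|]: the errors tend to 0
    pointwise.  Being bounded in norm, they tend to 0 coefficient by
    coefficient ([coef_cvg0]).  The partial expansions, whose squared norms are
    the partial sums of the [|l_k|^2] ([sqnorm_partial]), thus converge to [f]
    coefficientwise, so that the squared norm of [f] is at most the sum of the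
    [|l_k|^2].  Comparison with the identity above leaves nothing for the
    limit of [|f_m|^2].

    All of this takes place on square-summable sequences of Taylor
    coefficients.  Boundary values enter only through the pairing: every
    function in the Hardy space has one ([riesz_fischer], [dilate_approx]), any
    of them is the mean-square limit of the Taylor polynomials on the circle
    ([boundary_value_approximates]), and the orthogonality of the powers of
    [e^(it)] turns the pairing into the sum of the products of coefficients
    ([hardy2_dotE]). *)

Local Notation normc := (@Normc.normc _).

(** * Modulus and limits in the complex plane *)

Section ComplexModulus.
Variable R : realType.
Local Notation C := R[i].
Implicit Types x y z : C.

Lemma norm_normc z : `|z| = (normc z)%:C.
Proof. by rewrite normc_def; case: z. Qed.

Lemma normc0 : normc (0 : C) = 0.
Proof. exact: Normc.normc0. Qed.

Lemma normc_ge0 z : 0 <= normc z.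
Proof. by case: z => a b; rewrite sqrtr_ge0. Qed.

Lemma sqr_normcE z : normc z ^+ 2 = complex.Re z ^+ 2 + complex.Im z ^+ 2.
Proof. by case: z => a b /=; rewrite sqr_sqrtr // addr_ge0 // sqr_ge0. Qed.

Lemma normc_real (r : R) : normc r%:C = `|r|.
Proof. by rewrite /= expr0n addr0 sqrtr_sqr. Qed.

Lemma Re_sub x y : complex.Re (x - y) = complex.Re x - complex.Re y.
Proof. by case: x y => a b []. Qed.

Lemma Im_sub x y : complex.Im (x - y) = complex.Im x - complex.Im y.
Proof. by case: x y => a b []. Qed.

Lemma normcX z n : normc (z ^+ n) = normc z ^+ n.
Proof.
elim: n => [|n IH]; first by rewrite !expr0 Normc.normc1.
by rewrite !exprS Normc.normcM IH.
Qed.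

Lemma normc_conj z : normc (z^*) = normc z.
Proof. by case: z => a b /=; rewrite sqrrN. Qed.

Lemma normc_distC x y : normc (x - y) = normc (y - x).
Proof. by rewrite -normcN opprB. Qed.

Lemma normc_le_sum (I : Type) (s : seq I) (P : pred I) (F : I -> C) :
  normc (\sum_(i <- s | P i) F i) <= \sum_(i <- s | P i) normc (F i).
Proof.
elim/big_rec2: _ => [|i a b _ H]; first by rewrite normc0.
by apply: (le_trans (le_normcD _ _)); rewrite lerD2l.
Qed.

Lemma normc_lipschitz x y : `|normc x - normc y| <= normc (x - y).
Proof.
rewrite ler_norml; apply/andP; split.
  rewrite lerNl opprB lerBlDr -(normc_distC y).
  by rewrite (le_trans _ (le_normcD _ _)) // subrK.
by rewrite lerBlDr (le_trans _ (le_normcD _ _)) // subrK.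
Qed.

Lemma normc_Re_le z : `|complex.Re z| <= normc z.
Proof.
rewrite -(ler_pXn2r (n := 2)) ?nnegrE ?normc_ge0 //.
by rewrite real_normK ?num_real // sqr_normcE lerDl sqr_ge0.
Qed.

Lemma normc_Im_le z : `|complex.Im z| <= normc z.
Proof.
rewrite -(ler_pXn2r (n := 2)) ?nnegrE ?normc_ge0 //.
by rewrite real_normK ?num_real // sqr_normcE lerDr sqr_ge0.
Qed.

Lemma normc_le_ReIm z : normc z <= `|complex.Re z| + `|complex.Im z|.
Proof.
rewrite -(ler_pXn2r (n := 2)) ?nnegrE ?normc_ge0 ?addr_ge0 //.
rewrite sqr_normcE sqrrD !real_normK ?num_real // lerD2r lerDl.
by rewrite mulrn_wge0 // mulr_ge0.
Qed.

Lemma sqr_normcD x y :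
  normc (x + y) ^+ 2
  = normc x ^+ 2 + 2 * complex.Re (x * y^*) + normc y ^+ 2.
Proof. by rewrite !sqr_normcE; case: x y => a b [c d] /=; ring. Qed.

Lemma sqr_normcD_le x y :
  normc (x + y) ^+ 2 <= 2 * normc x ^+ 2 + 2 * normc y ^+ 2.
Proof.
rewrite !sqr_normcE; case: x y => a b [c d] /=.
have := sqr_ge0 (a - c); have := sqr_ge0 (b - d); nra.
Qed.

Lemma normc_eq0 z : (normc z == 0) = (z == 0).
Proof.
by apply/eqP/eqP => [/Normc.eq0_normc //|->]; exact: normc0.
Qed.

Lemma open_discE z : open_disc z <-> normc z < 1.
Proof. by rewrite /open_disc /= norm_normc -(rmorph1 (real_complex R)) ltcR. Qed.

(** The norm of the complex plane takes complex values; every limit is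
    estimated through the real modulus instead. *)
Lemma cvg_normcP (T : Type) (F : set_system T) {FF : Filter F} (u : T -> C) l :
  u @ F --> l <-> normc (u x - l) @[x --> F] --> (0 : R).
Proof.
split=> [/cvgrPdist_lt ul|/cvgrPdist_lt ul].
  apply/cvgrPdist_lt => e e0; have eC : 0 < e%:C by rewrite ltcR.
  have := ul _ eC; apply: filterS => x.
  rewrite norm_normc ltcR sub0r normrN ger0_norm ?normc_ge0 //.
  by rewrite normc_distC.
apply/cvgrPdist_lt => e e0.
have [r er] : exists r, e = r%:C by apply/complex_realP/gtr0_real.
rewrite er ltcR in e0; have := ul _ e0; apply: filterS => x.
rewrite sub0r normrN ger0_norm ?normc_ge0 // normc_distC er norm_normc.
by rewrite ltcR.
Qed.

Lemma cvg_ReImP (T : Type) (F : set_system T) {FF : Filter F} (u : T -> C) l :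
  complex.Re (u x) @[x --> F] --> complex.Re l ->
  complex.Im (u x) @[x --> F] --> complex.Im l -> u @ F --> l.
Proof.
move=> ur ui; apply/cvg_normcP.
have H : `|complex.Re (u x) - complex.Re l| + `|complex.Im (u x) - complex.Im l|
    @[x --> F] --> (0 : R).
  rewrite -[X in _ --> X](addr0 (0 : R)); apply: cvgD.
    by apply/norm_cvg0P/subr_cvg0.
  by apply/norm_cvg0P/subr_cvg0.
apply: (squeeze_cvgr _ (cvg_cst 0) H).
apply: nearW => x; rewrite normc_ge0 /=.
by rewrite -Re_sub -Im_sub normc_le_ReIm.
Qed.

Lemma cvg_normc (T : Type) (F : set_system T) {FF : Filter F} (u : T -> C) l :
  u @ F --> l -> normc (u x) @[x --> F] --> normc l.
Proof.
move=> /cvg_normcP H; apply/subr_cvg0/norm_cvg0P.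
apply: (squeeze_cvgr _ (cvg_cst 0) H); apply: nearW => x.
by rewrite normr_ge0 normc_lipschitz.
Qed.

Lemma cvg_Re (T : Type) (F : set_system T) {FF : Filter F} (u : T -> C) l :
  u @ F --> l -> complex.Re (u x) @[x --> F] --> complex.Re l.
Proof.
move=> /cvg_normcP H; apply/subr_cvg0/norm_cvg0P.
apply: (squeeze_cvgr _ (cvg_cst 0) H); apply: nearW => x.
by rewrite normr_ge0 -Re_sub normc_Re_le.
Qed.

Lemma cvg_Im (T : Type) (F : set_system T) {FF : Filter F} (u : T -> C) l :
  u @ F --> l -> complex.Im (u x) @[x --> F] --> complex.Im l.
Proof.
move=> /cvg_normcP H; apply/subr_cvg0/norm_cvg0P.
apply: (squeeze_cvgr _ (cvg_cst 0) H); apply: nearW => x.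
by rewrite normr_ge0 -Im_sub normc_Im_le.
Qed.

Lemma cvg_conjc (T : Type) (F : set_system T) {FF : Filter F} (u : T -> C) l :
  u @ F --> l -> (u x)^* @[x --> F] --> l^*.
Proof.
move=> /cvg_normcP H; apply/cvg_normcP.
by under eq_fun do rewrite -rmorphB normc_conj.
Qed.

End ComplexModulus.

(** * Power series with bounded coefficients *)

Section PowerSeries.
Variable R : realType.
Local Notation C := R[i].
Implicit Types (c d : nat -> C) (z : C) (M : R).

Definition peval c z : C := limn (series (fun k => c k * z ^+ k)).

Lemma Re_series (u : nat -> C) n :
  complex.Re (series u n) = series (fun k => complex.Re (u k)) n.
Proof.
rewrite /series /=; elim: n => [|n IH]; first by rewrite !big_geq.
by rewrite !big_nat_recr //= -IH; case: (\sum_(_ <= _ < _) _) (u n) => a b [].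
Qed.

Lemma Im_series (u : nat -> C) n :
  complex.Im (series u n) = series (fun k => complex.Im (u k)) n.
Proof.
rewrite /series /=; elim: n => [|n IH]; first by rewrite !big_geq.
by rewrite !big_nat_recr //= -IH; case: (\sum_(_ <= _ < _) _) (u n) => a b [].
Qed.

Lemma normc_series_cvg (u : nat -> C) :
  cvgn (series (fun k => normc (u k))) -> cvgn (series u).
Proof.
move=> cu.
have cre : cvgn (series (fun k => complex.Re (u k))).
  apply/normed_cvg/(series_le_cvg _ _ _ cu) => k //=.
    exact: normc_ge0.
  exact: normc_Re_le.
have cim : cvgn (series (fun k => complex.Im (u k))).
  apply/normed_cvg/(series_le_cvg _ _ _ cu) => k //=.
    exact: normc_ge0.
  exact: normc_Im_le.
apply/cvg_ex; exists (limn (series (fun k => complex.Re (u k))) +i*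
                      limn (series (fun k => complex.Im (u k)))).
apply: cvg_ReImP => /=.
  by rewrite (_ : (fun x => _) = series (fun k => complex.Re (u k)))//;
    apply/funext => n; rewrite Re_series.
by rewrite (_ : (fun x => _) = series (fun k => complex.Im (u k)))//;
  apply/funext => n; rewrite Im_series.
Qed.

Lemma cvgC_unique (T : Type) (F : set_system T) {FF : ProperFilter F}
  (u : T -> C) (l1 l2 : C) : u @ F --> l1 -> u @ F --> l2 -> l1 = l2.
Proof. by move=> /(cvg_lim (@norm_hausdorff _ C)) <- /(cvg_lim (@norm_hausdorff _ C)) <-. Qed.

Lemma peval_unique c z v :
  series (fun k => c k * z ^+ k) @ \oo --> v -> peval c z = v.
Proof. by move=> H; apply: cvg_lim. Qed.

Section Bounded.
Variables (c : nat -> C) (M : R).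
Hypothesis cM : forall k, normc (c k) <= M.

Let M0 : 0 <= M.
Proof. exact: le_trans (normc_ge0 _) (cM 0%N). Qed.

Lemma cvg_peval z : normc z < 1 ->
  series (fun k => c k * z ^+ k) @ \oo --> peval c z.
Proof.
move=> z1; apply: normc_series_cvg.
apply: (@series_le_cvg _ _ (geometric M (normc z))) => [k|k|k|] /=.
- exact: normc_ge0.
- by rewrite mulr_ge0 // exprn_ge0 ?normc_ge0.
- by rewrite Normc.normcM normcX ler_wpM2r ?cM // exprn_ge0 ?normc_ge0.
- by apply: is_cvg_geometric_series; rewrite ger0_norm ?normc_ge0.
Qed.

Lemma normc_peval_le z : normc z < 1 -> normc (peval c z) <= M / (1 - normc z).
Proof.
move=> z1; have H : normc (series (fun k => c k * z ^+ k) n) @[n --> \oo]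
    --> normc (peval c z) by apply: cvg_normc; exact: cvg_peval.
have z1' : `|normc z| < 1 by rewrite ger0_norm ?normc_ge0.
have := ler_cvg_to H (cvg_geometric_series (a := M) z1'); apply; apply: nearW => n.
apply: (le_trans (normc_le_sum _ _ _)); apply: ler_sum => k _ /=.
by rewrite Normc.normcM normcX ler_wpM2r ?cM // exprn_ge0 ?normc_ge0.
Qed.

End Bounded.

Lemma peval0 c : peval c 0 = c 0%N.
Proof.
apply: peval_unique; apply/cvg_normcP.
apply: (@cvg_trans _ (0 @[n --> \oo])); last exact: cvg_cst.
apply: near_eq_cvg; near=> n.
rewrite /series /= (@big_cat_nat _ _ _ 1%N) //=; last by near: n; exact: nbhs_infty_ge.
rewrite big_nat1 expr0 mulr1 big_nat big1 ?addr0 ?subrr ?normc0 //.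
by move=> k /andP[k1 _]; rewrite expr0n gtn_eqF // mulr0.
Unshelve. all: by end_near. Qed.

Lemma pevalD c d M z : (forall k, normc (c k) <= M) ->
  (forall k, normc (d k) <= M) -> normc z < 1 ->
  peval (fun k => c k + d k) z = peval c z + peval d z.
Proof.
move=> cM dM z1; apply: peval_unique.
rewrite (_ : series _ = series (fun k => c k * z ^+ k) \+ series (fun k => d k * z ^+ k)).
  by apply: cvgD; apply: cvg_peval; eassumption.
apply/funext => n; rewrite /series /= -big_split /=.
by apply: eq_bigr => k _; rewrite mulrDl.
Qed.

Lemma pevalZ c M z l : (forall k, normc (c k) <= M) -> normc z < 1 ->
  peval (fun k => l * c k) z = l * peval c z.
Proof.
move=> cM z1; apply: peval_unique.
rewrite (_ : series _ = (fun n => l * series (fun k => c k * z ^+ k) n)).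
  by apply: cvgM; [exact: cvg_cst|apply: cvg_peval; eassumption].
apply/funext => n; rewrite /series /= big_distrr /=.
by apply: eq_bigr => k _; rewrite mulrA.
Qed.

Lemma pevalS c M z : (forall k, normc (c k) <= M) -> normc z < 1 ->
  peval c z = c 0%N + z * peval (fun k => c k.+1) z.
Proof.
move=> cM z1; apply: peval_unique; rewrite -cvg_shiftS.
rewrite (_ : (fun n => _) = (fun n => c 0%N + z * series (fun k => c k.+1 * z ^+ k) n)).
  apply: cvgD; first exact: cvg_cst.
  by apply: cvgM; [exact: cvg_cst|apply: cvg_peval => // k; exact: cM].
apply/funext => n; rewrite /series /= big_nat_recl // expr0 mulr1; congr (_ + _).
by rewrite big_distrr /=; apply: eq_bigr => k _; rewrite exprS mulrCA.
Qed.

(** Bounded coefficients are continuous in the values of the power series: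
    the constant coefficient is the value at 0, and dividing the rest by [z]
    is harmless away from 0, hence also at 0 by the uniform bound on the
    shifted series. *)
Lemma coef_cvg0 (u : nat -> nat -> C) M :
  (forall m k, normc (u m k) <= M) ->
  (forall z, normc z < 1 -> peval (u m) z @[m --> \oo] --> (0 : C)) ->
  forall k, u m k @[m --> \oo] --> (0 : C).
Proof.
move=> uM u0 k; elim: k u uM u0 => [|k IH] u uM u0.
  under eq_fun do rewrite -peval0.
  by apply: u0; rewrite normc0.
have nz z : normc z < 1 -> z != 0 ->
    peval (fun k => u m k.+1) z @[m --> \oo] --> (0 : C).
  move=> z1 z0.
  have -> : (fun m => peval (fun k => u m k.+1) z)
          = (fun m => z^-1 * (peval (u m) z - peval (u m) 0)).
    apply/funext => m; rewrite (pevalS (uM m) z1) peval0 addrC addKr mulKf //.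
  rewrite -[X in _ --> X](mulr0 z^-1); apply: cvgM; first exact: cvg_cst.
  rewrite -[X in _ --> X]subr0; apply: cvgB; apply: u0 => //.
  by rewrite normc0.
apply: (IH (fun m k => u m k.+1)) => [m l|z z1]; first exact: uM.
have [->|] := eqVneq z 0; last exact: nz.
under eq_fun do rewrite peval0.
apply/cvg_normcP/cvgrPdist_le => e e0.
have M0 : 0 <= M := le_trans (normc_ge0 _) (uM 0%N 0%N).
pose r : R := Num.min (2^-1) (e / (4 * (M + 1))).
have r0 : 0 < r by rewrite lt_min invr_gt0 ltr0n divr_gt0 // mulr_gt0 // ltr_wpDl.
have r2 : r <= 2^-1 by rewrite ge_min lexx.
have rn : normc r%:C = r by rewrite normc_real gtr0_norm.
have r1 : normc r%:C < 1 by rewrite rn; lra.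
have rC : r%:C != 0 :> C by rewrite -normc_eq0 rn gt_eqF.
have /cvg_normcP/cvgrPdist_le/(_ (e / 2)) := nz _ r1 rC.
rewrite divr_gt0 // => /(_ isT); apply: filterS => m.
rewrite !subr0 !sub0r !normrN !ger0_norm ?normc_ge0 // => H.
have cM : forall l, normc (u m l.+1) <= M by [].
have := pevalS cM r1.
set E := peval _ _ => HE.
have -> : u m 1%N = E - r%:C * peval (fun k => u m k.+2) r%:C by rewrite HE addrK.
apply: (le_trans (le_normcD _ _)); rewrite normcN Normc.normcM rn.
have cM' : forall l, normc (u m l.+2) <= M by [].
have := normc_peval_le cM' r1; rewrite rn => H2.
have H3 : M / (1 - r) <= 2 * M.
  by rewrite ler_pdivrMr; [nra|lra].
have H4 : r * (4 * (M + 1)) <= e.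
  by rewrite -ler_pdivlMr ?ge_min ?lexx ?orbT // mulr_gt0 // ltr_wpDl.
rewrite (splitr e) lerD //.
apply: (@le_trans _ _ (r * (2 * M))); last nra.
by apply: ler_wpM2l; [exact: ltW|exact: le_trans H3].
Qed.

End PowerSeries.

(** * Square-summable Taylor coefficients *)

Section SquareSummable.
Variable R : realType.
Local Notation C := R[i].
Implicit Types (c d g p q : nat -> C) (a z l : C) (M : R).

Definition sqnorm c : R := limn (series (fun k => normc (c k) ^+ 2)).

Lemma square_summableP c : square_summable c <->
  exists M, forall n, \sum_(0 <= k < n) normc (c k) ^+ 2 <= M.
Proof.
have H0 k : true -> (0 <= (normc (c k) ^+ 2)%:E)%E by rewrite lee_fin sqr_ge0.
split=> [cs|[M cM]].
  exists (fine (\sum_(0 <= k <oo) (normc (c k) ^+ 2)%:E)%E) => n.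
  rewrite -lee_fin fineK; last first.
    by rewrite ge0_fin_numE // nneseries_ge0 // => k _ _; exact: H0.
  by rewrite -sumEFin; apply: nneseries_lim_ge => *; rewrite lee_fin sqr_ge0.
apply: (@le_lt_trans _ _ M%:E); last by rewrite ltry.
apply: lime_le; first by apply: is_cvg_nneseries => *; rewrite lee_fin sqr_ge0.
by apply: nearW => n; rewrite sumEFin lee_fin.
Qed.

Lemma square_summable_le c (u : nat -> R) M :
  (forall n, \sum_(0 <= k < n) u k <= M) ->
  (forall k, normc (c k) ^+ 2 <= u k) -> square_summable c.
Proof.
move=> uM cu; apply/square_summableP; exists M => n.
by apply: le_trans (uM n); apply: ler_sum.
Qed.

Lemma cvg_sqnorm c : square_summable c ->
  series (fun k => normc (c k) ^+ 2) @ \oo --> sqnorm c.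
Proof.
move=> /square_summableP[M cM]; apply: nondecreasing_is_cvgn.
  by apply: nondecreasing_series => n _ _; exact: sqr_ge0.
by exists M => _ [n _ <-]; exact: cM.
Qed.

Lemma sum_le_sqnorm c n : square_summable c ->
  \sum_(0 <= k < n) normc (c k) ^+ 2 <= sqnorm c.
Proof.
move=> /cvg_sqnorm H; apply: (cvgr_to_ge H).
exists n => // m /= nm; rewrite /series /= (@big_cat_nat _ _ _ n 0 m) //= lerDl.
by apply: sumr_ge0 => k _; exact: sqr_ge0.
Qed.

Lemma sqnorm_le c M :
  (forall n, \sum_(0 <= k < n) normc (c k) ^+ 2 <= M) -> sqnorm c <= M.
Proof.
move=> cM; have /cvg_sqnorm H : square_summable c.
  by apply/square_summableP; exists M.
by apply: (cvgr_to_le H); apply: nearW.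
Qed.

Lemma sqnorm_ge0 c : square_summable c -> 0 <= sqnorm c.
Proof. by move=> /(sum_le_sqnorm 0); rewrite big_geq. Qed.

Lemma nneseries_sqnorm c : square_summable c ->
  (\sum_(0 <= k <oo) (normc (c k) ^+ 2)%:E)%E = (sqnorm c)%:E.
Proof.
move=> /cvg_sqnorm H; apply: cvg_lim => //.
rewrite (_ : (fun n => _) = EFin \o series (fun k => normc (c k) ^+ 2)).
  by apply: cvg_EFin => //; apply: nearW.
by apply/funext => n /=; rewrite sumEFin.
Qed.

Lemma normc_le_sqnorm c k : square_summable c ->
  normc (c k) <= Num.sqrt (sqnorm c).
Proof.
move=> cs; rewrite -(ler_pXn2r (n := 2)) ?nnegrE ?normc_ge0 ?sqrtr_ge0 //.
rewrite sqr_sqrtr ?sqnorm_ge0 //; apply: le_trans (sum_le_sqnorm k.+1 cs).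
by rewrite big_nat_recr //= lerDr sumr_ge0 // => i _; exact: sqr_ge0.
Qed.

Lemma square_summableD c d : square_summable c -> square_summable d ->
  square_summable (fun k => c k + d k).
Proof.
move=> cs ds; apply: (@square_summable_le _
  (fun k => 2 * normc (c k) ^+ 2 + 2 * normc (d k) ^+ 2)
  (2 * sqnorm c + 2 * sqnorm d)) => [n|k]; last exact: sqr_normcD_le.
by rewrite big_split /= -!big_distrr /= lerD // ler_wpM2l // sum_le_sqnorm.
Qed.

Lemma square_summableZ l c : square_summable c ->
  square_summable (fun k => l * c k).
Proof.
move=> cs; apply: (@square_summable_le _
  (fun k => normc l ^+ 2 * normc (c k) ^+ 2) (normc l ^+ 2 * sqnorm c)).
  by move=> n; rewrite -big_distrr /= ler_wpM2l ?sqr_ge0 // sum_le_sqnorm.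
by move=> k; rewrite Normc.normcM exprMn.
Qed.

Lemma square_summable0 : square_summable (fun _ : nat => 0 : C).
Proof.
apply/square_summableP; exists 0 => n.
by rewrite big1 // => i _; rewrite normc0 expr0n.
Qed.

Lemma sqnorm0 : sqnorm (fun _ => 0) = 0.
Proof.
apply/eqP; rewrite eq_le sqnorm_ge0 ?andbT; last exact: square_summable0.
by apply: sqnorm_le => n; rewrite big1 // => i _; rewrite normc0 expr0n.
Qed.

Lemma cvg_peval_l2 c z : square_summable c -> normc z < 1 ->
  series (fun k => c k * z ^+ k) @ \oo --> peval c z.
Proof. by move=> cs; apply: cvg_peval => k; exact: normc_le_sqnorm. Qed.

Lemma pevalS_l2 c z : square_summable c -> normc z < 1 ->
  peval c z = c 0%N + z * peval (fun k => c k.+1) z.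
Proof. by move=> cs; apply: pevalS => k; exact: normc_le_sqnorm. Qed.

Lemma pevalZ_l2 l c z : square_summable c -> normc z < 1 ->
  peval (fun k => l * c k) z = l * peval c z.
Proof. by move=> cs; apply: pevalZ => k; exact: normc_le_sqnorm. Qed.

Lemma pevalD_l2 c d z : square_summable c -> square_summable d ->
  normc z < 1 -> peval (fun k => c k + d k) z = peval c z + peval d z.
Proof.
move=> cs ds; apply: (@pevalD _ _ _ (Num.max (Num.sqrt (sqnorm c)) (Num.sqrt (sqnorm d)))) => k.
  by rewrite le_max normc_le_sqnorm.
by rewrite le_max (normc_le_sqnorm k ds) orbT.
Qed.

Lemma square_summable_shift c m : square_summable c ->
  square_summable (fun k => c (m + k)%N).
Proof.
move=> cs; apply/square_summableP; exists (sqnorm c) => n.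
apply: le_trans (sum_le_sqnorm (m + n) cs).
rewrite [leRHS](@big_cat_nat _ _ _ m) ?leq_addr //=.
rewrite -{3}(add0n m) big_addn addnC addnK.
under [X in _ <= _ + X]eq_bigr do rewrite addnC.
by rewrite lerDr sumr_ge0 // => i _; exact: sqr_ge0.
Qed.

Definition rshift p k : C := if k is k'.+1 then p k' else 0.

Lemma square_summable_rshift p : square_summable p ->
  square_summable (rshift p).
Proof.
move=> ps; apply/square_summableP; exists (sqnorm p) => -[|n].
  by rewrite big_geq // sqnorm_ge0.
by rewrite big_nat_recl // {1}/rshift normc0 expr0n add0r sum_le_sqnorm.
Qed.

Lemma peval_rshift p z : square_summable p -> normc z < 1 ->
  peval (rshift p) z = z * peval p z.
Proof.
move=> ps z1; rewrite pevalS_l2 //= ?add0r //; exact: square_summable_rshift.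
Qed.

(** Convexity of the squared modulus: [x + a y] is the mean of
    [x / (1 - |a|)] and [y], up to phase, with weights [1 - |a|] and [|a|]. *)
Lemma sqr_normc_convex a x y : normc a < 1 ->
  normc (x + a * y) ^+ 2
  <= normc x ^+ 2 / (1 - normc a) + normc a * normc y ^+ 2.
Proof.
move=> a1; have s0 := normc_ge0 a; set s := normc a in a1 s0 *.
have := le_normcD x (a * y); rewrite Normc.normcM -/s => H.
have x0 := normc_ge0 x; have y0 := normc_ge0 y.
apply: (@le_trans _ _ ((normc x + s * normc y) ^+ 2)).
  by rewrite ler_pXn2r ?nnegrE ?normc_ge0 // addr_ge0 // mulr_ge0.
rewrite -(ler_pM2r (x := 1 - s)) ?subr_gt0 // mulrDl divfK; last lra.
set u := normc x in x0 *; set v := normc y in y0 *.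
rewrite -subr_ge0.
have -> : u ^+ 2 + s * v ^+ 2 * (1 - s) - (u + s * v) ^+ 2 * (1 - s)
  = s * (u - (1 - s) * v) ^+ 2 by ring.
by rewrite mulr_ge0 // sqr_ge0.
Qed.

(** The Taylor coefficients of [g z / (1 - a^* z)]. *)
Fixpoint over_denom a g n : C :=
  if n is n'.+1 then g n + a^* * over_denom a g n' else g 0%N.

Local Arguments over_denom : simpl never.

(** The recursion for the coefficients contracts by the factor [|a|]; summing
    the convexity inequality bounds the sum of squares by a part of itself. *)
Lemma square_summable_over_denom a g : normc a < 1 -> square_summable g ->
  square_summable (over_denom a g).
Proof.
move=> a1 gs; have s0 := normc_ge0 a; set s := normc a in a1 s0 *.
apply/square_summableP; exists (sqnorm g / (1 - s) / (1 - s)) => n.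
set p := over_denom a g.
have H n' : (1 - s) * \sum_(0 <= k < n'.+1) normc (p k) ^+ 2
    + s * normc (p n') ^+ 2 <= (\sum_(0 <= k < n'.+1) normc (g k) ^+ 2) / (1 - s).
  elim: n' => [|m IH].
    rewrite !big_nat1 /= ler_pdivlMr ?subr_gt0 //.
    have := sqr_ge0 (normc (g 0%N)); nra.
  rewrite big_nat_recr //= (big_nat_recr m.+1) //= (mulrDl _ _ (1 - s)^-1).
  have := @sqr_normc_convex (a^*) (g m.+1) (p m).
  rewrite normc_conj -/s => /(_ a1); rewrite -/(p m.+1) /= => H.
  move: IH H; set A := \sum_(_ <= _ < _) _; set B := (\sum_(_ <= _ < _) _) / _.
  set X := normc (p m) ^+ 2; set Y := normc (_ + _) ^+ 2; set Z := _ / _.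
  lra.
case: n => [|n].
  by rewrite big_geq // !divr_ge0 ?sqnorm_ge0 ?subr_ge0 ?ltW.
rewrite ler_pdivlMr ?subr_gt0 // mulrC.
apply: (@le_trans _ _ ((\sum_(0 <= k < n.+1) normc (g k) ^+ 2) / (1 - s))).
  by apply: le_trans (H n); rewrite lerDl mulr_ge0 // sqr_ge0.
by rewrite ler_wpM2r ?invr_ge0 ?subr_ge0 ?(ltW a1) // sum_le_sqnorm.
Qed.

Lemma over_denomE a g :
  over_denom a g = (fun k => g k + a^* * rshift (over_denom a g) k).
Proof. by apply/funext => -[|k] //=; rewrite mulr0 addr0. Qed.

Lemma denom_neq0 a z : normc a < 1 -> normc z < 1 -> 1 - a^* * z != 0.
Proof.
move=> a1 z1; rewrite subr_eq0; apply: contraTneq (ltr01 : (0 : R) < 1) => H.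
have : normc (a^* * z) < 1.
  rewrite Normc.normcM normc_conj.
  by rewrite (le_lt_trans _ z1) // ler_piMl ?normc_ge0 // ltW.
by rewrite -H Normc.normc1 ltxx.
Qed.

Lemma peval_over_denom a g z : normc a < 1 -> square_summable g ->
  normc z < 1 -> peval (over_denom a g) z = peval g z / (1 - a^* * z).
Proof.
move=> a1 gs z1; have ps := square_summable_over_denom a1 gs.
apply: (mulIf (denom_neq0 a1 z1)); rewrite divfK ?denom_neq0 //.
set e := LHS; have -> : peval g z = e; last by [].
rewrite /e; apply/eqP; rewrite mulrBr mulr1 eq_sym subr_eq; apply/eqP.
rewrite {1}over_denomE pevalD_l2 ?pevalZ_l2 ?peval_rshift //.
- by congr (_ + _); ring.
- exact: square_summable_rshift.
- by apply: square_summableZ; exact: square_summable_rshift.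
Qed.

Definition mobius_mul a g k : C :=
  rshift (over_denom a g) k + - a * over_denom a g k.

Lemma square_summable_mobius_mul a g : normc a < 1 -> square_summable g ->
  square_summable (mobius_mul a g).
Proof.
move=> a1 gs; have ps := square_summable_over_denom a1 gs.
by apply: square_summableD; [exact: square_summable_rshift|exact: square_summableZ].
Qed.

Lemma peval_mobius_mul a g z : normc a < 1 -> square_summable g ->
  normc z < 1 -> peval (mobius_mul a g) z = mobius a z * peval g z.
Proof.
move=> a1 gs z1; have ps := square_summable_over_denom a1 gs.
rewrite /mobius_mul pevalD_l2 ?peval_rshift ?pevalZ_l2 //.
- by rewrite peval_over_denom // /mobius; ring.
- exact: square_summable_rshift.
- exact: square_summableZ.
Qed.

Lemma sqr_normc_mobius a x y :
  normc (x + - a * y) ^+ 2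
  = normc (y - a^* * x) ^+ 2 - (1 - normc a ^+ 2) * (normc y ^+ 2 - normc x ^+ 2).
Proof. by rewrite !sqr_normcE; case: a x y => ? ? [? ?] [? ?] /=; ring. Qed.

(** With [p z = g z / (1 - a^* z)], the function [g] is [(1 - a^* z) p] and its
    product with the Moebius factor is [(z - a) p].  The squared moduli of the
    coefficients of these two multiples of [p] differ by a telescoping
    amount. *)
Lemma sqnorm_mobius_mul a g : normc a < 1 -> square_summable g ->
  sqnorm (mobius_mul a g) = sqnorm g.
Proof.
move=> a1 gs; have ps := square_summable_over_denom a1 gs.
set p := over_denom a g in ps *.
have gE k : g k = p k - a^* * rshift p k.
  by rewrite /p {1}over_denomE addrK.
have T n : series (fun k => normc (mobius_mul a g k) ^+ 2) n.+1
    = series (fun k => normc (g k) ^+ 2) n.+1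
      - (1 - normc a ^+ 2) * normc (p n) ^+ 2.
  rewrite /series /=; elim: n => [|n IH].
    rewrite !big_nat1 gE /mobius_mul /= add0r mulr0 subr0 Normc.normcM normcN.
    by rewrite exprMn -/(p 0%N) /=; ring.
  rewrite big_nat_recr //= IH [in RHS]big_nat_recr //= gE /mobius_mul /= -/p.
  by rewrite sqr_normc_mobius; ring.
have H : series (fun k => normc (mobius_mul a g k) ^+ 2) @ \oo --> sqnorm g.
  rewrite -[sqnorm g]subr0 -[X in _ - X](mulr0 (1 - normc a ^+ 2)).
  rewrite -cvg_shiftS (funext T : (fun n => _) = _).
  apply: cvgB; first by rewrite cvg_shiftS; exact: cvg_sqnorm.
  apply: cvgM; first exact: cvg_cst.
  apply: (@cvg_series_cvg_0 _ _ (fun k => normc (p k) ^+ 2)).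
  exact: (cvgP _ (cvg_sqnorm ps)).
exact: (cvg_lim _ H).
Qed.

(** The Taylor coefficients of the difference quotient
    [(g z - g a) / (z - a)].  They are given by values of shifted series, and
    not by dividing tails by powers of [a], because [a] may be 0. *)
Definition diff_quot a g n : C := peval (fun k => g (n.+1 + k)%N) a.

Lemma diff_quotE a g n : normc a < 1 -> square_summable g ->
  diff_quot a g n = g n.+1 + a * diff_quot a g n.+1.
Proof.
move=> a1 gs; rewrite /diff_quot pevalS_l2 ?addn0 //; last exact: square_summable_shift.
by congr (_ + _ * peval _ _); apply/funext => k; rewrite addnS addSn.
Qed.

(** The recursion [diff_quotE] runs downwards: its last term is controlled by
    the uniform bound [rb] on the values of the shifted series. *)
Lemma square_summable_diff_quot a g : normc a < 1 -> square_summable g ->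
  square_summable (diff_quot a g).
Proof.
move=> a1 gs; have s0 := normc_ge0 a; set s := normc a in a1 s0 *.
set r := diff_quot a g.
have rb n : normc (r n) <= Num.sqrt (sqnorm g) / (1 - s).
  by apply: normc_peval_le => // k; exact: normc_le_sqnorm.
set B := _ / _ in rb.
apply/square_summableP.
exists ((sqnorm g / (1 - s) + s * B ^+ 2) / (1 - s)) => n.
rewrite ler_pdivlMr ?subr_gt0 // mulrC.
have H : (1 - s) * \sum_(0 <= k < n) normc (r k) ^+ 2
  <= (\sum_(0 <= k < n) normc (g k.+1) ^+ 2) / (1 - s)
     + s * (normc (r n) ^+ 2 - normc (r 0%N) ^+ 2).
  elim: n => [|n IH]; first by rewrite !big_geq // subrr !mulr0 mul0r addr0.
  rewrite big_nat_recr //= (big_nat_recr n) //= (mulrDl _ _ (1 - s)^-1).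
  have := @sqr_normc_convex a (g n.+1) (r n.+1) a1.
  rewrite -/s -diff_quotE // -/r => H.
  move: IH H; set A := \sum_(_ <= _ < _) _; set D := (\sum_(_ <= _ < _) _) / _.
  set X := normc (r n) ^+ 2; set Z := _ / _.
  lra.
apply: (le_trans H); apply: lerD.
  rewrite ler_wpM2r ?invr_ge0 ?subr_ge0 ?(ltW a1) //.
  apply: le_trans (sum_le_sqnorm n.+1 gs).
  by rewrite big_nat_recl // lerDr sqr_ge0.
rewrite ler_wpM2l // (@le_trans _ _ (normc (r n) ^+ 2)) //.
  by rewrite gerBl sqr_ge0.
by rewrite ler_pXn2r ?nnegrE ?normc_ge0 // (le_trans (normc_ge0 _) (rb n)).
Qed.

Lemma peval_diff_quot a g z : normc a < 1 -> square_summable g ->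
  normc z < 1 -> peval g z = peval g a + (z - a) * peval (diff_quot a g) z.
Proof.
move=> a1 gs z1; have rs := square_summable_diff_quot a1 gs.
have := pevalS_l2 rs z1.
rewrite (pevalS_l2 gs z1) (pevalS_l2 gs a1).
rewrite (_ : (fun k => g k.+1) = (fun k => diff_quot a g k + - a * diff_quot a g k.+1)); last first.
  by apply/funext => k; rewrite (diff_quotE _ a1 gs) mulNr addrK.
have rs1 := square_summable_shift 1 rs.
rewrite !pevalD_l2 ?pevalZ_l2 //; try exact: square_summableZ.
rewrite (pevalS_l2 rs a1).
set X := peval (diff_quot _ _) z; set Y := peval _ z; set Z := peval _ a.
by move=> ->; ring.
Qed.

Definition szego_coef a k : C :=
  (Num.sqrt (1 - normc a ^+ 2))%:C * (a^*) ^+ k.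

Lemma szego_scale_sqr a : normc a < 1 ->
  (Num.sqrt (1 - normc a ^+ 2)) ^+ 2 = 1 - normc a ^+ 2.
Proof.
move=> a1; rewrite sqr_sqrtr // subr_ge0 expr_le1 ?normc_ge0 // ltW //.
Qed.

Lemma cvg_szego_sqnorm a : normc a < 1 ->
  series (fun k => normc (szego_coef a k) ^+ 2) @ \oo --> (1 : R).
Proof.
move=> a1; have a2 : `|normc a ^+ 2| < 1.
  by rewrite ger0_norm ?sqr_ge0 // expr_lt1 ?normc_ge0.
have := cvg_geometric_series (a := 1 - normc a ^+ 2) a2.
rewrite mulfV; last by rewrite subr_eq0 gt_eqF // (le_lt_trans _ a2) // ler_norm.
rewrite (_ : geometric _ _ = (fun k => normc (szego_coef a k) ^+ 2)) //.
apply/funext => k /=; rewrite /szego_coef Normc.normcM normc_real normcX.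
by rewrite normc_conj [in RHS]exprMn ger0_norm ?sqrtr_ge0 // szego_scale_sqr // exprAC.
Qed.

Lemma square_summable_szego a : normc a < 1 -> square_summable (szego_coef a).
Proof.
move=> /cvg_szego_sqnorm H; apply/square_summableP; exists 1 => n.
apply: (cvgr_to_ge H); exists n => // m /= nm.
rewrite /series /= (@big_cat_nat _ _ _ n 0 m) //= lerDl.
by apply: sumr_ge0 => k _; exact: sqr_ge0.
Qed.

Lemma peval_szego a z : normc a < 1 -> normc z < 1 ->
  peval (szego_coef a) z = szego a z.
Proof.
move=> a1 z1; have ss := square_summable_szego a1.
rewrite /szego; apply: (mulIf (denom_neq0 a1 z1)); rewrite divfK ?denom_neq0 //.
have := pevalS_l2 ss z1.
rewrite (_ : (fun k => szego_coef a k.+1) = (fun k => a^* * szego_coef a k)).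
  rewrite (pevalZ_l2 _ ss z1).
  rewrite (_ : szego_coef a 0 = (Num.sqrt (1 - normc a ^+ 2))%:C) => [E|]; last first.
    by rewrite /szego_coef expr0 mulr1.
  by rewrite mulrBr mulr1 {1}E; ring.
by apply/funext => k; rewrite /szego_coef (exprS (a^*)); ring.
Qed.

(** The pairing with the kernel at [a] is the value at [a], up to a factor:
    this makes functions vanishing at [a] orthogonal to the kernel. *)
Lemma sqnorm_szegoD a l g : normc a < 1 -> square_summable g ->
  peval g a = 0 ->
  sqnorm (fun k => l * szego_coef a k + g k) = normc l ^+ 2 + sqnorm g.
Proof.
move=> a1 gs ga; apply: cvg_lim => //.
pose s := Num.sqrt (1 - normc a ^+ 2).
pose S n := series (fun k => g k * a ^+ k) n.
rewrite (_ : series _ = (fun n =>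
    normc l ^+ 2 * series (fun k => normc (szego_coef a k) ^+ 2) n
    + 2 * complex.Re (l * s%:C * (S n)^*)
    + series (fun k => normc (g k) ^+ 2) n)); last first.
  apply/funext => n; rewrite /S /series /=.
  elim: n => [|n IH]; first by rewrite !big_geq // rmorph0 !mulr0 !addr0.
  rewrite !big_nat_recr //= IH sqr_normcD Normc.normcM exprMn.
  have -> : l * s%:C * (\sum_(0 <= k < n) g k * a ^+ k + g n * a ^+ n)^*
     = l * s%:C * (\sum_(0 <= k < n) g k * a ^+ k)^* + l * szego_coef a n * (g n)^*.
    rewrite rmorphD /= rmorphM rmorphXn /= /szego_coef -/s; ring.
  rewrite [in RHS](_ : complex.Re (_ + _)
      = complex.Re (l * s%:C * (\sum_(0 <= k < n) g k * a ^+ k)^*)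
        + complex.Re (l * szego_coef a n * (g n)^*)); last first.
    by case: (_ * _) (_ * (g n)^*) => ? ? [].
  by ring.
rewrite (_ : normc l ^+ 2 + sqnorm g
  = normc l ^+ 2 * 1 + 2 * complex.Re (l * s%:C * 0^*) + sqnorm g); last first.
  by rewrite rmorph0 !mulr0 addr0 mulr1.
apply: cvgD; last exact: cvg_sqnorm.
apply: cvgD.
  by apply: cvgM; [exact: cvg_cst|exact: cvg_szego_sqnorm].
apply: cvgM; first exact: cvg_cst.
apply: cvg_Re; apply: cvgM; first exact: cvg_cst.
apply: cvg_conjc; rewrite -[X in _ --> X]ga; exact: cvg_peval_l2.
Qed.
End SquareSummable.

(** * Trigonometric polynomials on the circle *)

Section CircleIntegral.
Variable R : realType.
Local Notation C := R[i].
Local Notation mu := (@lebesgue_measure R).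
Local Notation D := (@circle R).
Local Notation ReP h := (fun t => complex.Re (h t)).
Local Notation ImP h := (fun t => complex.Im (h t)).
Implicit Types (h k : R -> C) (l : C) (c d : nat -> C).

Definition cmeasurable h :=
  measurable_fun D (ReP h) /\ measurable_fun D (ImP h).

Definition cintegrable h :=
  mu.-integrable D (EFin \o ReP h) /\ mu.-integrable D (EFin \o ImP h).

Definition ccontinuous h := continuous (ReP h : R -> R) /\ continuous (ImP h : R -> R).

Lemma measurable_circle : measurable D.
Proof. exact: measurable_itv. Qed.

Lemma pi2_gt0 : 0 < 2 * pi :> R.
Proof. by rewrite mulr_gt0 // pi_gt0. Qed.

Lemma measure_circle : mu D = (2 * pi)%:E.
Proof.
by rewrite lebesgue_measure_itv /= lte_fin pi2_gt0 oppr0 adde0.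
Qed.

Lemma Re_add (x y : C) : complex.Re (x + y) = complex.Re x + complex.Re y.
Proof. by case: x y => a b []. Qed.

Lemma Im_add (x y : C) : complex.Im (x + y) = complex.Im x + complex.Im y.
Proof. by case: x y => a b []. Qed.

Lemma Re_mul (x y : C) : complex.Re (x * y)
  = complex.Re x * complex.Re y - complex.Im x * complex.Im y.
Proof. by case: x y => a b []. Qed.

Lemma Im_mul (x y : C) : complex.Im (x * y)
  = complex.Re x * complex.Im y + complex.Im x * complex.Re y.
Proof. by case: x y => a b []. Qed.

Lemma Re_cconj (x : C) : complex.Re (x^*) = complex.Re x.
Proof. by case: x. Qed.

Lemma Im_cconj (x : C) : complex.Im (x^*) = - complex.Im x.
Proof. by case: x. Qed.

Lemma complexP (x y : C) :
  complex.Re x = complex.Re y -> complex.Im x = complex.Im y -> x = y.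
Proof. by case: x y => a b [c d] /= -> ->. Qed.

Lemma ccontinuousD h k : ccontinuous h -> ccontinuous k ->
  ccontinuous (fun t => h t + k t).
Proof.
move=> [h1 h2] [k1 k2]; split => t.
  rewrite (_ : (fun t => _) = (fun t => complex.Re (h t) + complex.Re (k t))).
    by apply: cvgD; [exact: h1|exact: k1].
  by apply/funext => x; rewrite Re_add.
rewrite (_ : (fun t => _) = (fun t => complex.Im (h t) + complex.Im (k t))).
  by apply: cvgD; [exact: h2|exact: k2].
by apply/funext => x; rewrite Im_add.
Qed.

Lemma ccontinuousM h k : ccontinuous h -> ccontinuous k ->
  ccontinuous (fun t => h t * k t).
Proof.
move=> [h1 h2] [k1 k2]; split => t.
  rewrite (_ : (fun t => _) = (fun t => complex.Re (h t) * complex.Re (k t)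
      - complex.Im (h t) * complex.Im (k t))).
    by apply: cvgB; apply: cvgM; [exact: h1|exact: k1|exact: h2|exact: k2].
  by apply/funext => x; rewrite Re_mul.
rewrite (_ : (fun t => _) = (fun t => complex.Re (h t) * complex.Im (k t)
    + complex.Im (h t) * complex.Re (k t))).
  by apply: cvgD; apply: cvgM; [exact: h1|exact: k2|exact: h2|exact: k1].
by apply/funext => x; rewrite Im_mul.
Qed.

Lemma ccontinuous_cst l : ccontinuous (fun _ => l).
Proof. by split => t; exact: cvg_cst. Qed.

Lemma ccontinuous_conj h : ccontinuous h -> ccontinuous (fun t => (h t)^*).
Proof.
move=> [h1 h2]; split => t; first by under eq_fun do rewrite Re_cconj; exact: h1.
rewrite (_ : (fun t => _) = (fun t => - complex.Im (h t))).
  by apply: cvgN; exact: h2.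
by apply/funext => x; rewrite Im_cconj.
Qed.

Lemma ccontinuous_sum (I : Type) (s : seq I) (P : pred I) (h : I -> R -> C) :
  (forall i, ccontinuous (h i)) ->
  ccontinuous (fun t => \sum_(i <- s | P i) h i t).
Proof.
move=> hc; elim: s => [|i s IH].
  by under eq_fun do rewrite big_nil; exact: ccontinuous_cst.
under eq_fun do rewrite big_cons.
by case: (P i) => //; exact: ccontinuousD.
Qed.

Lemma ccontinuous_expit n : ccontinuous (fun t => expit t ^+ n).
Proof.
elim: n => [|n IH]; first by under eq_fun do rewrite expr0; exact: ccontinuous_cst.
under eq_fun do rewrite exprS; apply: ccontinuousM => //.
by split => t; [exact: continuous_cos|exact: continuous_sin].
Qed.

Lemma ccontinuous_measurable h : ccontinuous h -> cmeasurable h.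
Proof.
move=> [h1 h2]; split; apply: measurable_funTS; exact: measurable_realfun.continuous_measurable_fun.
Qed.

Lemma ccontinuous_integrable h : ccontinuous h -> cintegrable h.
Proof.
move=> [h1 h2]; split; apply: continuous_compact_integrable;
  try exact: segment_compact; exact: continuous_subspaceT.
Qed.

Lemma cintegrableD h k : cintegrable h -> cintegrable k ->
  cintegrable (fun t => h t + k t).
Proof.
move=> [h1 h2] [k1 k2]; split; apply: eq_integrable; try exact: measurable_circle.
- by move=> t _ /=; rewrite Re_add EFinD.
- by apply: integrableD => //; exact: measurable_circle.
- by move=> t _ /=; rewrite Im_add EFinD.
- by apply: integrableD => //; exact: measurable_circle.
Qed.

Lemma circle_integralD h k : cintegrable h -> cintegrable k ->
  circle_integral (fun t => h t + k t) = circle_integral h + circle_integral k.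
Proof.
move=> [h1 h2] [k1 k2]; rewrite /circle_integral; apply: complexP.
  rewrite Re_add /= -RintegralD //; last exact: measurable_circle.
  by apply: eq_Rintegral => t _; rewrite Re_add.
rewrite Im_add /= -RintegralD //; last exact: measurable_circle.
by apply: eq_Rintegral => t _; rewrite Im_add.
Qed.

Lemma cintegrableZ l h : cintegrable h -> cintegrable (fun t => l * h t).
Proof.
move=> [h1 h2]; split; apply: eq_integrable; try exact: measurable_circle.
- by move=> t _ /=; rewrite Re_mul EFinB !EFinM.
- apply: integrableB; first exact: measurable_circle.
    by apply: integrableZl => //; exact: measurable_circle.
  by apply: integrableZl => //; exact: measurable_circle.
- by move=> t _ /=; rewrite Im_mul EFinD !EFinM.
- apply: integrableD; first exact: measurable_circle.
    by apply: integrableZl => //; exact: measurable_circle.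
  by apply: integrableZl => //; exact: measurable_circle.
Qed.

Let integrableZl_fun (r : R) (u : R -> R) : measurable D ->
  mu.-integrable D (EFin \o u) -> mu.-integrable D (EFin \o (fun t => r * u t)).
Proof.
move=> mD iu; apply: eq_integrable; try exact: mD.
  by move=> t _ /=; rewrite EFinM.
exact: integrableZl.
Qed.

Lemma circle_integralZ l h : cintegrable h ->
  circle_integral (fun t => l * h t) = l * circle_integral h.
Proof.
move=> [h1 h2]; rewrite /circle_integral; apply: complexP.
  rewrite Re_mul /= -!RintegralZl //; try exact: measurable_circle.
  rewrite -RintegralB; try exact: measurable_circle.
  - by apply: eq_Rintegral => t _; rewrite Re_mul.
  - by apply: integrableZl_fun => //; exact: measurable_circle.
  - by apply: integrableZl_fun => //; exact: measurable_circle.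
rewrite Im_mul /= -!RintegralZl //; try exact: measurable_circle.
rewrite -RintegralD; try exact: measurable_circle.
- by apply: eq_Rintegral => t _; rewrite Im_mul.
- by apply: integrableZl_fun => //; exact: measurable_circle.
- by apply: integrableZl_fun => //; exact: measurable_circle.
Qed.

Lemma circle_integral0 : circle_integral (fun _ => 0 : C) = 0.
Proof.
have := circle_integralZ 0 (ccontinuous_integrable (ccontinuous_cst 0)).
by under eq_fun do rewrite mul0r; rewrite mul0r.
Qed.

Lemma cintegrable_sum (I : Type) (s : seq I) (h : I -> R -> C) :
  (forall i, cintegrable (h i)) ->
  cintegrable (fun t => \sum_(i <- s) h i t).
Proof.
move=> hi; elim: s => [|i s IH].
  under eq_fun do rewrite big_nil.
  exact/ccontinuous_integrable/ccontinuous_cst.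
by under eq_fun do rewrite big_cons; exact: cintegrableD.
Qed.

Lemma circle_integral_sum (I : Type) (s : seq I) (h : I -> R -> C) :
  (forall i, cintegrable (h i)) ->
  circle_integral (fun t => \sum_(i <- s) h i t)
  = \sum_(i <- s) circle_integral (h i).
Proof.
move=> hi; elim: s => [|i s IH].
  by under eq_fun do rewrite big_nil; rewrite big_nil circle_integral0.
under eq_fun do rewrite big_cons.
by rewrite big_cons circle_integralD ?IH //; exact: cintegrable_sum.
Qed.

Lemma circle_integral_conj h : cintegrable h ->
  circle_integral (fun t => (h t)^*) = (circle_integral h)^*.
Proof.
move=> [h1 h2]; rewrite /circle_integral; apply: complexP.
  by rewrite Re_cconj /=; apply: eq_Rintegral => t _; rewrite Re_cconj.
rewrite Im_cconj /= -mulN1r -RintegralZl //; last exact: measurable_circle.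
by apply: eq_Rintegral => t _; rewrite Im_cconj mulN1r.
Qed.

Lemma expitX (t : R) n : expit t ^+ n = expit (n%:R * t).
Proof.
elim: n => [|n IH]; first by rewrite expr0 mul0r /expit cos0 sin0.
rewrite exprS IH -natr1 mulrDl mul1r addrC /expit cosD sinD.
by apply: complexP; rewrite ?Re_mul ?Im_mul /=; ring.
Qed.

Lemma expit_conj (t : R) : expit t * (expit t)^* = 1.
Proof.
apply: complexP; rewrite ?Re_mul ?Im_mul Re_cconj Im_cconj /=; last by ring.
by rewrite mulrN opprK -!expr2 cos2Dsin2.
Qed.

(** By the fundamental theorem of calculus; this gives the orthogonality of
    the powers of [expit]. *)
Lemma Rintegral_periodic_derive (u U : R -> R) : continuous u ->
  (forall t, is_derive t (1 : R) U (u t)) -> U (2 * pi) = U 0 ->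
  \int[mu]_(t in D) u t = 0.
Proof.
move=> cu dU U2; rewrite /Rintegral.
rewrite (@continuous_FTC2 _ u U) ?pi2_gt0 ?U2 ?subee //.
- exact: continuous_subspaceT.
- have cU t : {for t, continuous U}.
    by apply/differentiable_continuous/derivable1_diffP; case: (dU t).
  split => [t _||]; first by case: (dU t).
  + by apply: cvg_at_right_filter; exact: cU.
  + by apply: cvg_at_left_filter; exact: cU.
- by move=> t _; rewrite derive1E; apply: derive_val.
Qed.

Lemma circle_integral_expit n : (0 < n)%N ->
  circle_integral (fun t : R => expit t ^+ n) = 0.
Proof.
move=> n0; have nR : n%:R != 0 :> R by rewrite pnatr_eq0 -lt0n.
have E : (fun t : R => expit t ^+ n) = (fun t => expit (n%:R * t)).
  by apply/funext => t; rewrite expitX.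
rewrite E.
have c0 (t : R) : {for t, continuous (fun t : R => n%:R * t)}.
  by apply: cvgM; [exact: cvg_cst|exact: cvg_id].
have c1 : continuous (fun t : R => cos (n%:R * t)).
  by move=> t; apply: continuous_comp; [exact: c0|exact: continuous_cos].
have c2 : continuous (fun t : R => sin (n%:R * t)).
  by move=> t; apply: continuous_comp; [exact: c0|exact: continuous_sin].
have per : n%:R * (2 * pi) = 0 + pi *+ 2 *+ n :> R.
  by rewrite add0r -[RHS]mulr_natl -[pi *+ 2]mulr_natl.
apply: complexP => /=.
  apply: (@Rintegral_periodic_derive _ (fun t => n%:R^-1 * sin (n%:R * t))) => //.
    move=> t; apply: is_derive_eq; rewrite /GRing.scale /=.
    by field.
  by rewrite per (periodicn (@sinD2pi R)) mulr0.
apply: (@Rintegral_periodic_derive _ (fun t => - n%:R^-1 * cos (n%:R * t))) => //.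
  move=> t; apply: is_derive_eq; rewrite /GRing.scale /=.
  by field.
by rewrite per (periodicn (@cosD2pi R)) mulr0.
Qed.

Lemma circle_integral_expit_conj n m :
  circle_integral (fun t : R => expit t ^+ n * (expit t ^+ m)^*)
  = if n == m then (2 * pi)%:C else 0.
Proof.
have M1 (r : R) : \int[mu]_(t in D) r = r * (2 * pi).
  rewrite /Rintegral (integral_cst mu measurable_circle r%:E).
  by rewrite [X in (_ * X)%E]measure_circle.
have H p q : (p <= q)%N ->
    circle_integral (fun t : R => expit t ^+ q * (expit t ^+ p)^*)
    = if q == p then (2 * pi)%:C else 0.
  move=> pq; rewrite (_ : (fun t => _) = (fun t => expit t ^+ (q - p))).
    have [->|qp] := eqVneq q p.
      rewrite subnn /circle_integral; apply: complexP => /=.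
        by rewrite M1 mul1r.
      by rewrite M1 mul0r.
    by rewrite circle_integral_expit // subn_gt0 ltn_neqAle pq eq_sym qp.
  apply/funext => t; rewrite -{1}(subnK pq) exprD rmorphXn /= -mulrA -exprMn.
  by rewrite expit_conj expr1n mulr1.
have [mn|/ltnW nm] := leqP m n; first exact: H.
have := H _ _ nm => /(congr1 Num.conj); rewrite -circle_integral_conj; last first.
  apply/ccontinuous_integrable/ccontinuousM; first exact: ccontinuous_expit.
  exact/ccontinuous_conj/ccontinuous_expit.
under eq_fun do rewrite rmorphM /= conjCK mulrC.
move=> ->; rewrite eq_sym; case: eqP => _; last by rewrite rmorph0.
by apply: complexP => //=; rewrite oppr0.
Qed.

Definition trigpoly c n (t : R) : C := \sum_(0 <= k < n) c k * expit t ^+ k.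

Lemma ccontinuous_trigpoly c n : ccontinuous (trigpoly c n).
Proof.
apply: ccontinuous_sum => k; apply: ccontinuousM; first exact: ccontinuous_cst.
exact: ccontinuous_expit.
Qed.

Lemma circle_integral_trigpoly c d n :
  circle_integral (fun t => trigpoly c n t * (trigpoly d n t)^*)
  = (2 * pi)%:C * \sum_(0 <= k < n) c k * (d k)^*.
Proof.
have ci (k l : nat) : cintegrable (fun t => (c k * (d l)^*) * (expit t ^+ k * (expit t ^+ l)^*)).
  apply/cintegrableZ/ccontinuous_integrable/ccontinuousM.
    exact: ccontinuous_expit.
  exact/ccontinuous_conj/ccontinuous_expit.
rewrite (_ : (fun t => _) = (fun t => \sum_(0 <= k < n) \sum_(0 <= l < n)
    (c k * (d l)^*) * (expit t ^+ k * (expit t ^+ l)^*))); last first.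
  apply/funext => t; rewrite /trigpoly rmorph_sum /= big_distrlr /=.
  by apply: eq_bigr => k _; apply: eq_bigr => l _; rewrite rmorphM /=; ring.
rewrite circle_integral_sum => [|k]; last exact: cintegrable_sum.
rewrite big_distrr /= !big_nat; apply: eq_bigr => k /andP[_ kn].
rewrite circle_integral_sum // (bigD1_seq k) ?mem_index_iota ?iota_uniq //=.
rewrite circle_integralZ; last first.
  apply/ccontinuous_integrable/ccontinuousM; first exact: ccontinuous_expit.
  exact/ccontinuous_conj/ccontinuous_expit.
rewrite circle_integral_expit_conj eqxx mulrC big1 ?addr0 // => l lk.
rewrite circle_integralZ; last first.
  apply/ccontinuous_integrable/ccontinuousM; first exact: ccontinuous_expit.
  exact/ccontinuous_conj/ccontinuous_expit.
by rewrite circle_integral_expit_conj eq_sym (negbTE lk) mulr0.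
Qed.

Definition sqint h : \bar R := (\int[mu]_(t in D) (normc (h t) ^+ 2)%:E)%E.

Lemma trigpoly_sqint c n :
  sqint (trigpoly c n) = (2 * pi * \sum_(0 <= k < n) normc (c k) ^+ 2)%:E.
Proof.
have H := circle_integral_trigpoly c c n.
have E t : complex.Re (trigpoly c n t * (trigpoly c n t)^*) = normc (trigpoly c n t) ^+ 2.
  by rewrite Re_mul Re_cconj Im_cconj sqr_normcE; ring.
have [ci _] : cintegrable (fun t => trigpoly c n t * (trigpoly c n t)^*).
  apply/ccontinuous_integrable/ccontinuousM; first exact: ccontinuous_trigpoly.
  exact/ccontinuous_conj/ccontinuous_trigpoly.
have := congr1 (@complex.Re R) H; rewrite /circle_integral /= /Rintegral.
under eq_integral do rewrite E.
move=> H1; rewrite /sqint -[LHS]fineK ?H1; last first.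
  have -> : (fun t => (normc (trigpoly c n t) ^+ 2)%:E)
    = EFin \o ReP (fun t => trigpoly c n t * (trigpoly c n t)^*).
    by apply/funext => t /=; rewrite -E.
  by apply: integrable_fin_num => //; exact: measurable_circle.
congr EFin; rewrite Re_mul /= mul0r subr0; congr (_ * _).
elim: n {H ci H1 E} => [|n IH]; first by rewrite !big_geq.
rewrite !big_nat_recr //= Re_add IH; congr (_ + _).
by rewrite Re_mul Re_cconj Im_cconj sqr_normcE; ring.
Qed.

End CircleIntegral.

(** * Boundary values and the reproducing kernel *)

Section BoundaryValue.
Variable R : realType.
Local Notation C := R[i].
Local Notation mu := (@lebesgue_measure R).
Local Notation D := (@circle R).
Local Notation ReP h := (fun t => complex.Re (h t)).
Local Notation ImP h := (fun t => complex.Im (h t)).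
Implicit Types (h u v F G : R -> C) (l : C) (c d : nat -> C) (f g : C -> C).

Lemma cmeasurableD h k : cmeasurable h -> cmeasurable k ->
  cmeasurable (fun t => h t + k t).
Proof.
move=> [h1 h2] [k1 k2]; split.
  rewrite (_ : (fun t => _) = ReP h \+ ReP k); first exact: measurable_funD.
  by apply/funext => t /=; rewrite Re_add.
rewrite (_ : (fun t => _) = ImP h \+ ImP k); first exact: measurable_funD.
by apply/funext => t /=; rewrite Im_add.
Qed.

Lemma cmeasurableM h k : cmeasurable h -> cmeasurable k ->
  cmeasurable (fun t => h t * k t).
Proof.
move=> [h1 h2] [k1 k2]; split.
  rewrite (_ : (fun t => _) = (ReP h \* ReP k) \- (ImP h \* ImP k)).
    by apply: measurable_funB; apply: measurable_funM.
  by apply/funext => t /=; rewrite Re_mul.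
rewrite (_ : (fun t => _) = (ReP h \* ImP k) \+ (ImP h \* ReP k)).
  by apply: measurable_funD; apply: measurable_funM.
by apply/funext => t /=; rewrite Im_mul.
Qed.

Lemma cmeasurable_cst l : cmeasurable (fun _ : R => l).
Proof. by split; exact: measurable_cst. Qed.

Lemma cmeasurableB h k : cmeasurable h -> cmeasurable k ->
  cmeasurable (fun t => h t - k t).
Proof.
move=> mh mk; rewrite (_ : (fun t => _) = (fun t => h t + -1 * k t)).
  by apply: cmeasurableD => //; apply: cmeasurableM => //; exact: cmeasurable_cst.
by apply/funext => t; rewrite mulN1r.
Qed.

Lemma cmeasurable_conj h : cmeasurable h -> cmeasurable (fun t => (h t)^*).
Proof.
move=> [h1 h2]; split; first by under eq_fun do rewrite Re_cconj.
rewrite (_ : (fun t => _) = \- ImP h); last by apply/funext => t /=; rewrite Im_cconj.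
exact: measurableT_comp.
Qed.

Lemma cmeasurable_cvg (h : nat -> R -> C) k : (forall n, cmeasurable (h n)) ->
  (forall t, D t -> h n t @[n --> \oo] --> k t) -> cmeasurable k.
Proof.
move=> mh hk; split.
  apply: (@measurable_fun_cvg _ _ _ _ (fun n => ReP (h n))).
    by move=> n; case: (mh n).
  by move=> t Dt; apply: cvg_Re; exact: hk.
apply: (@measurable_fun_cvg _ _ _ _ (fun n => ImP (h n))).
  by move=> n; case: (mh n).
by move=> t Dt; apply: cvg_Im; exact: hk.
Qed.

Lemma cmeasurable_trigpoly c n : cmeasurable (trigpoly c n).
Proof. exact/ccontinuous_measurable/ccontinuous_trigpoly. Qed.

Lemma measurable_sqr_normc h : cmeasurable h ->
  measurable_fun D (fun t => (normc (h t) ^+ 2)%:E).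
Proof.
move=> [h1 h2]; apply/measurable_EFinP.
rewrite (_ : (fun t => _) = (fun t => ReP h t ^+ 2) \+ (fun t => ImP h t ^+ 2)).
  by apply: measurable_funD; apply: measurable_funX.
by apply/funext => t /=; rewrite sqr_normcE.
Qed.

Lemma sqint_ge0 h : (0 <= sqint h)%E.
Proof. by apply: integral_ge0 => t _; rewrite lee_fin sqr_ge0. Qed.

Lemma sqintD_le h k (A B : R) : cmeasurable h -> cmeasurable k ->
  (sqint h <= A%:E -> sqint k <= B%:E ->
  sqint (fun t => (h t + k t)%R) <= (2 * A + 2 * B)%:E)%E.
Proof.
move=> mh mk hA kB.
have m2 u : cmeasurable u -> measurable_fun D (fun t => (2 * normc (u t) ^+ 2)%:E).
  move=> /measurable_sqr_normc/measurable_EFinP mu2; apply/measurable_EFinP.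
  by apply: measurable_funM => //; exact: measurable_cst.
have i2 u (M : R) : cmeasurable u -> (sqint u <= M%:E)%E ->
    (\int[mu]_(t in D) (2 * normc (u t) ^+ 2)%:E <= (2 * M)%:E)%E.
  move=> mu2 uM; under eq_integral do rewrite EFinM.
  rewrite ge0_integralZl_EFin //.
  - by rewrite EFinM; apply: lee_wpmul2l.
  - exact: measurable_circle.
  - by move=> t _; rewrite lee_fin sqr_ge0.
  - exact: measurable_sqr_normc.
apply: (@le_trans _ _ (\int[mu]_(t in D)
    ((2 * normc (h t) ^+ 2)%:E + (2 * normc (k t) ^+ 2)%:E))%E).
  apply: ge0_le_integral => //.
  - exact: measurable_circle.
  - by move=> t _; rewrite lee_fin sqr_ge0.
  - by apply: measurable_sqr_normc; exact: cmeasurableD.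
  - by apply: emeasurable_funD; exact: m2.
  - by move=> t _; rewrite -EFinD lee_fin sqr_normcD_le.
rewrite ge0_integralD //.
- by rewrite EFinD; apply: leeD; exact: i2.
- exact: measurable_circle.
- by move=> t _; rewrite lee_fin mulr_ge0 // sqr_ge0.
- exact: m2.
- by move=> t _; rewrite lee_fin mulr_ge0 // sqr_ge0.
- exact: m2.
Qed.

(** Serves both for the almost everywhere limit in [riesz_fischer] and for the
    dilates, whose power series converge pointwise on the circle. *)
Lemma sqint_fatou (h : nat -> R -> C) k (B : R) :
  (forall n, cmeasurable (h n)) -> cmeasurable k ->
  {ae mu, forall t, D t -> h n t @[n --> \oo] --> k t} ->
  (forall n, (sqint (h n) <= B%:E)%E) -> (sqint k <= B%:E)%E.
Proof.
move=> mh mk hk hB.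
have mE n := measurable_sqr_normc (mh n).
have h0 n t : D t -> (0 <= (normc (h n t) ^+ 2)%:E)%E by rewrite lee_fin sqr_ge0.
apply: (@le_trans _ _ (\int[mu]_(t in D) limn_einf (fun n => (normc (h n t) ^+ 2)%:E))%E).
  apply: ae_ge0_le_integral.
  - exact: measurable_circle.
  - by move=> t _; rewrite lee_fin sqr_ge0.
  - exact: measurable_sqr_normc.
  - move=> t _; rewrite limn_einf_lim; apply: lime_ge; first exact: is_cvg_einfs.
    apply: nearW => n; apply: le_ereal_inf_tmp => _ [m _ <-].
    by rewrite lee_fin sqr_ge0.
  - apply: (emeasurable_fun_cvg (fun n t => einfs (fun m => (normc (h m t) ^+ 2)%:E) n)).
      exact: measurable_fun_einfs mE.
    by move=> t _; rewrite limn_einf_lim; exact: is_cvg_einfs.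
  - move: hk; apply: negligibleS => t /= nH H; apply: nH => Dt.
    have := H Dt => /cvg_normc/(_ _) {}H.
    have E : (normc (h n t) ^+ 2)%:E @[n --> \oo] --> (normc (k t) ^+ 2)%:E.
      apply: cvg_EFin; first exact: nearW.
      rewrite expr2; under eq_fun do rewrite /= expr2.
      by apply: cvgM; exact: H.
    by rewrite (cvg_limn_einf_sup E).1.
have Hf := fatou mu (@measurable_circle R) mE h0.
apply: (le_trans Hf).
rewrite limn_einf_lim; apply: lime_le; first exact: is_cvg_einfs.
apply: nearW => n; apply: le_trans (hB n).
by apply: ereal_inf_lbound; exists n => //=.
Qed.

Lemma trigpolyB_sqint c d m n : (m <= n)%N ->
  sqint (fun t => trigpoly c n t - trigpoly d m t)
  = (2 * pi * (\sum_(0 <= k < m) normc (c k - d k) ^+ 2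
               + \sum_(m <= k < n) normc (c k) ^+ 2))%:E.
Proof.
move=> mn; pose e k := c k - (if (k < m)%N then d k else 0).
rewrite (_ : (fun t => _) = trigpoly e n).
  rewrite trigpoly_sqint (@big_cat_nat _ _ _ m 0 n) //=; congr (_ * (_ + _))%:E.
    by rewrite !big_nat; apply: eq_bigr => k /andP[_ km]; rewrite /e km.
  by rewrite !big_nat; apply: eq_bigr => k /andP[mk _]; rewrite /e ltnNge mk subr0.
apply/funext => t; rewrite /trigpoly !(@big_cat_nat _ _ _ m 0 n) //= addrAC -sumrB.
congr (_ + _); rewrite !big_nat; apply: eq_bigr => k /andP[mk km].
  by rewrite /e km -mulrBl.
by rewrite /e ltnNge mk subr0.
Qed.

Lemma square_summable_tail c (e : R) : square_summable c -> 0 < e ->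
  exists N, forall m n, (N <= m)%N -> \sum_(m <= k < n) normc (c k) ^+ 2 <= e.
Proof.
move=> cs e0; have /cvgrPdist_lt/(_ _ e0)[N _ HN] := cvg_sqnorm cs.
exists N => m n Nm; have [nm|/ltnW mn] := leqP n m.
  by rewrite big_geq // ltW.
have := HN m Nm; rewrite /series /= => /(le_lt_trans (ler_norm _)) H.
have := sum_le_sqnorm n cs; rewrite (@big_cat_nat _ _ _ m 0 n) //=.
by move: H; lra.
Qed.

(** By orthogonality, the squared distance of two partial sums is a block of
    the convergent series of squared moduli. *)
Lemma trigpoly_cauchy c (e : R) : square_summable c -> 0 < e ->
  exists N, forall m n, (N <= m)%N -> (m <= n)%N ->
  (sqint (fun t => (trigpoly c n t - trigpoly c m t)%R) <= e%:E)%E.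
Proof.
move=> cs e0; have p0 := pi2_gt0 R.
have [N HN] := square_summable_tail cs (divr_gt0 e0 p0).
exists N => m n Nm mn; rewrite trigpolyB_sqint // lee_fin.
rewrite big1 => [|k _]; last by rewrite subrr normc0 expr0n.
by rewrite add0r mulrC -ler_pdivlMr // HN.
Qed.

(** The partial sums tend to [F] in mean square.  The convergence is spelled out
    by bounds because the integrals take values in the extended reals. *)
Definition approximates c F : Prop := forall e : R, 0 < e ->
  exists N, forall m, (N <= m)%N ->
  (sqint (fun t => (F t - trigpoly c m t)%R) <= e%:E)%E.

(** The series of the [2^j |D_j|^2], where [D_j] are the increments, has a
    finite integral, hence is finite almost everywhere; and there
    [|D_j| <= 2^j |D_j|^2 + 2^-j] makes the increments absolutely summable. *)
Lemma ae_cvg_subseq c (M : nat -> nat) : 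
  (forall j, (sqint (fun t => (trigpoly c (M j.+1) t - trigpoly c (M j) t)%R)
     <= ((4^-1) ^+ j)%:E)%E) ->
  {ae mu, forall t, D t -> cvgn (fun j => trigpoly c (M j) t)}.
Proof.
move=> HM.
pose Dl j t := trigpoly c (M j.+1) t - trigpoly c (M j) t.
have mDl j : cmeasurable (Dl j) by apply: cmeasurableB; exact: cmeasurable_trigpoly.
pose w j t := (2 ^+ j * normc (Dl j t) ^+ 2)%:E.
have w0 j t : D t -> (0 <= w j t)%E.
  by move=> _; rewrite /w lee_fin mulr_ge0 ?exprn_ge0 ?normc_ge0.
have mw j : measurable_fun D (w j).
  apply/measurable_EFinP/measurable_funM; first exact: measurable_cst.
  by apply/measurable_EFinP; exact: measurable_sqr_normc.
have iw j : (\int[mu]_(t in D) w j t <= ((2^-1) ^+ j)%:E)%E.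
  rewrite /w; under eq_integral do rewrite EFinM.
  rewrite ge0_integralZl_EFin //.
  - apply: (le_trans (lee_wpmul2l _ (HM j))); first by rewrite lee_fin exprn_ge0.
    by rewrite -EFinM lee_fin -exprMn (_ : 2 * 4^-1 = 2^-1) //; field.
  - exact: measurable_circle.
  - by move=> t _; rewrite lee_fin sqr_ge0.
  - exact: measurable_sqr_normc.
have iS : mu.-integrable D (fun t => \sum_(j <oo) w j t)%E.
  apply/integrableP; split.
    apply: (ge0_emeasurable_sum (P := xpredT)) => [j t Dt _|j _]; [exact: w0|exact: mw].
  under eq_integral => t tD.
    rewrite gee0_abs; last by apply: nneseries_ge0 => j _ _; apply: w0; exact: set_mem.
    over.
  rewrite integral_nneseries //; last exact: measurable_circle.
  apply: (@le_lt_trans _ _ (\sum_(j <oo) ((2^-1) ^+ j)%:E)%E).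
    apply: lee_nneseries => [j _ _|j _]; last exact: iw.
    by apply: integral_ge0 => t Dt; exact: w0.
  apply: (@le_lt_trans _ _ (1 * (1 - 2^-1)^-1)%:E); last by rewrite ltry.
  apply: lime_le; first by apply: is_cvg_nneseries => *; rewrite lee_fin exprn_ge0.
  apply: nearW => n; rewrite sumEFin lee_fin.
  have h1 : 0 < 2^-1 :> R by rewrite invr_gt0.
  have h2 : `|2^-1| < 1 :> R by rewrite gtr0_norm // invf_lt1 // ltr1n.
  have := geometric_le_lim n ler01 h1 h2; apply: le_trans.
  by rewrite le_eqVlt; apply/orP; left; apply/eqP; apply: eq_bigr => j _ /=; rewrite mul1r.
have := @integrable_ae _ _ _ mu D (@measurable_circle R) _ iS.
apply: negligibleS => t /= nH H; apply: nH => Dt.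
have {H} := H Dt => Hf.
have c1 : cvgn (series (fun j => 2 ^+ j * normc (Dl j t) ^+ 2)).
  apply: nondecreasing_is_cvgn.
    by apply: nondecreasing_series => n _ _; rewrite mulr_ge0 ?exprn_ge0 ?normc_ge0.
  exists (fine (\sum_(j <oo) w j t)%E) => _ [n _ <-].
  rewrite -lee_fin fineK // /series /= -sumEFin.
  by apply: nneseries_lim_ge => j _ _; exact: w0.
have c2 : cvgn (series (fun j => (2^-1 : R) ^+ j)).
  have := @is_cvg_geometric_series R 1 (2^-1).
  rewrite (_ : geometric _ _ = (fun j => (2^-1 : R) ^+ j)).
    by apply; rewrite ger0_norm // invf_lt1 // ltr1n.
  by apply/funext => j /=; rewrite mul1r.
have c3 : cvgn (series (fun j => Dl j t)).
  apply: normc_series_cvg.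
  apply: (@series_le_cvg _ _ (fun j => 2 ^+ j * normc (Dl j t) ^+ 2 + (2^-1) ^+ j)).
  - by move=> j; exact: normc_ge0.
  - by move=> j; rewrite addr_ge0 ?mulr_ge0 ?exprn_ge0 ?sqr_ge0 ?normc_ge0.
  - move=> j; rewrite exprVn; have : 0 < 2 ^+ j :> R by rewrite exprn_gt0.
    set x := normc _; set s := 2 ^+ j => s0.
    rewrite -(ler_pM2l s0) mulrDr mulfV ?gt_eqF //.
    have := sqr_ge0 (s * x - 1); have := normc_ge0 (Dl j t); rewrite -/x => x0.
    have := mulr_ge0 (ltW s0) x0.
    nra.
  - rewrite (_ : series _ = series (fun j => 2 ^+ j * normc (Dl j t) ^+ 2)
      \+ series (fun j => (2^-1) ^+ j)); first exact: is_cvgD.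
    by apply/funext => n; rewrite /series /= big_split.
rewrite (_ : (fun j => _) = (fun j => trigpoly c (M 0%N) t + series (fun j => Dl j t) j)).
  have c4 : trigpoly c (M 0%N) t + series (fun j => Dl j t) j @[j --> \oo]
      --> trigpoly c (M 0%N) t + limn (series (fun j => Dl j t)).
    by apply: cvgD; [exact: cvg_cst|exact: c3].
  exact: (cvgP _ c4).
apply/funext => j; rewrite /series /= telescope_sumr // addrC subrK //.
Qed.

(** [F] is the almost everywhere limit of the partial sums along a sparse set of
    indices; Fatou's lemma turns this into a mean-square limit of all of
    them. *)
Lemma riesz_fischer c : square_summable c ->
  exists2 F, cmeasurable F & approximates c F.
Proof.
move=> cs.
have e0 j : 0 < (4^-1 : R) ^+ j by rewrite exprn_gt0 // invr_gt0.
have /choice[N HN] := fun j => trigpoly_cauchy cs (e0 j).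
(* Summing the indices makes them increasing and unbounded. *)
pose M j := (\sum_(0 <= i < j.+1) (N i).+1)%N.
have MS j : M j.+1 = (M j + (N j.+1).+1)%N by rewrite /M big_nat_recr.
have MN j : (N j <= M j)%N.
  by rewrite /M big_nat_recr //= (leq_trans (leqnSn _)) // leq_addl.
have Mj j : (j <= M j)%N.
  by elim: j => [|j IH] //; rewrite MS addnS ltnS (leq_trans IH) // leq_addr.
have /ae_cvg_subseq cM : forall j,
    (sqint (fun t => (trigpoly c (M j.+1) t - trigpoly c (M j) t)%R) <= ((4^-1) ^+ j)%:E)%E.
  by move=> j; apply: HN => //; rewrite MS leq_addr.
(* The upper limit is measurable without knowing where the sequence converges,
   and is the limit where it does. *)
pose F t : C := fine (limn_esup (fun j => (complex.Re (trigpoly c (M j) t))%:E))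
             +i* fine (limn_esup (fun j => (complex.Im (trigpoly c (M j) t))%:E)).
have mF : cmeasurable F.
  split; apply: measurableT_comp => //; apply: measurable_fun_limn_esup => j;
    apply/measurable_EFinP; by case: (cmeasurable_trigpoly c (M j)).
have FM t : cvgn (fun j => trigpoly c (M j) t) ->
    trigpoly c (M j) t @[j --> \oo] --> F t.
  move=> H; have := H; set l := limn _ => Hl.
  have E1 : (complex.Re (trigpoly c (M j) t))%:E @[j --> \oo] --> (complex.Re l)%:E.
    by apply: cvg_EFin; [exact: nearW|exact: cvg_Re].
  have E2 : (complex.Im (trigpoly c (M j) t))%:E @[j --> \oo] --> (complex.Im l)%:E.
    by apply: cvg_EFin; [exact: nearW|exact: cvg_Im].
  rewrite /F (cvg_limn_einf_sup E1).2 (cvg_limn_einf_sup E2).2 /=.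
  by case: l Hl {E1 E2}.
exists F => // e e1; have [K HK] := trigpoly_cauchy cs e1.
exists K => m Km.
apply: (@sqint_fatou (fun j t => trigpoly c (M (j + m)%N) t - trigpoly c m t)).
- by move=> n; apply: cmeasurableB; exact: cmeasurable_trigpoly.
- by apply: cmeasurableB => //; exact: cmeasurable_trigpoly.
- move: cM; apply: negligibleS => t /= nH H; apply: nH => Dt.
  apply: cvgB; last exact: cvg_cst.
  have := FM t (H Dt); rewrite -(cvg_shiftn m); exact.
- by move=> n; apply: HK => //; rewrite (leq_trans _ (Mj _)) // leq_addl.
Qed.

Lemma cvg_sum_nat (T : Type) (H : set_system T) {FH : Filter H}
    (u : nat -> T -> R) (v : nat -> R) m :
  (forall k, u k x @[x --> H] --> v k) ->
  \sum_(0 <= k < m) u k x @[x --> H] --> \sum_(0 <= k < m) v k.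
Proof.
move=> uk; elim: m => [|m IH].
  by rewrite big_geq //; under eq_fun do rewrite big_geq //; exact: cvg_cst.
rewrite (_ : (fun x => _) = (fun x => \sum_(0 <= k < m) u k x + u m x)).
  by rewrite big_nat_recr //=; apply: cvgD.
by apply/funext => x; rewrite big_nat_recr.
Qed.

Lemma normc_expit (t : R) : normc (expit t) = 1.
Proof. by rewrite /= cos2Dsin2 sqrtr1. Qed.

(** The difference consists of the coefficients before [m], damped by
    [r ^ k - 1], and of a tail that is small uniformly in [r]; only the first
    part needs [r] to be close to 1. *)
Lemma dilate_approx c (e : R) : square_summable c -> 0 < e ->
  exists N, forall m, (N <= m)%N -> \forall r \near (1 : R)^'-,
  (sqint (fun t => (peval c (r%:C * expit t) - trigpoly c m t)%R) <= e%:E)%E.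
Proof.
move=> cs e0; have p0 := pi2_gt0 R; pose e1 := e / (2 * pi) / 2.
have e10 : 0 < e1 by rewrite !divr_gt0.
have [N HN] := square_summable_tail cs e10; exists N => m Nm.
have S0 : \sum_(0 <= k < m) normc (c k * r%:C ^+ k - c k) ^+ 2 @[r --> (1 : R)^'-] --> (0 : R).
  rewrite [X in _ --> X](_ : 0 = \sum_(0 <= k < m) 0); last by rewrite big1.
  apply: cvg_sum_nat => k.
  rewrite (_ : (fun r => _) = (fun r => normc (c k) ^+ 2 * (r ^+ k - 1) ^+ 2)).
    rewrite [X in _ --> X](_ : 0 = normc (c k) ^+ 2 * (1 ^+ k - 1) ^+ 2); last first.
      by rewrite expr1n subrr expr0n mulr0.
    apply: cvg_at_left_filter.
    apply: cvgM; first exact: cvg_cst.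
    rewrite expr2; under eq_fun do rewrite expr2.
    by apply: cvgM; apply: cvgB; (try exact: cvg_cst); exact: exprn_continuous.
  apply/funext => r; rewrite (_ : c k * _ - c k = c k * (r ^+ k - 1)%:C).
    by rewrite Normc.normcM normc_real exprMn real_normK ?num_real.
  by rewrite rmorphB rmorphXn rmorph1 /=; ring.
have := S0 => /cvgrPdist_le/(_ _ e10) H.
near=> r.
have r0 : 0 < r by near: r; exact: nbhs_left_gt.
have r1 : r < 1 by near: r; exact: nbhs_left_lt.
have Sr : \sum_(0 <= k < m) normc (c k * r%:C ^+ k - c k) ^+ 2 <= e1.
  have : `|0 - \sum_(0 <= k < m) normc (c k * r%:C ^+ k - c k) ^+ 2| <= e1 by near: r.
  by rewrite sub0r normrN; apply: le_trans; exact: ler_norm.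
pose cr k := c k * r%:C ^+ k.
have nr t : normc (r%:C * expit t) < 1.
  by rewrite Normc.normcM normc_expit mulr1 normc_real gtr0_norm.
have cvr t : trigpoly cr n t @[n --> \oo] --> peval c (r%:C * expit t).
  rewrite (_ : (fun n => _) = series (fun k => c k * (r%:C * expit t) ^+ k)).
    exact: cvg_peval_l2.
  by apply/funext => n; apply: eq_bigr => k _; rewrite /cr exprMn mulrA.
apply: (@sqint_fatou (fun n t => trigpoly cr (m + n)%N t - trigpoly c m t)).
- by move=> n; apply: cmeasurableB; exact: cmeasurable_trigpoly.
- apply: cmeasurableB; last exact: cmeasurable_trigpoly.
  apply: (@cmeasurable_cvg (trigpoly cr)) => [n|t _]; last exact: cvr.
  exact: cmeasurable_trigpoly.
- apply: aeW => t Dt; apply: cvgB; last exact: cvg_cst.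
  by under eq_fun do rewrite addnC; have := cvr t; rewrite -(cvg_shiftn m); exact.
- move=> n; rewrite trigpolyB_sqint ?leq_addr // lee_fin mulrC.
  rewrite -ler_pdivlMr // [leRHS](splitr) -/e1 lerD //.
  apply: le_trans (HN m (m + n)%N Nm); apply: ler_sum => k _.
  rewrite /cr Normc.normcM normcX normc_real gtr0_norm //.
  rewrite ler_pXn2r ?nnegrE ?mulr_ge0 ?exprn_ge0 ?normc_ge0 ?(ltW r0) //.
  by rewrite ler_piMr ?normc_ge0 // exprn_ile1 // ltW.
Unshelve. all: by end_near. Qed.


Definition has_coefs f c := square_summable c /\ power_series_on_disc f c.

Lemma has_coefsE f c z : has_coefs f c -> normc z < 1 -> f z = peval c z.
Proof. by move=> [_ H] z1; rewrite (peval_unique (H z _)) //; exact/open_discE. Qed.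

Lemma dilate_sqint f c h (r : R) : has_coefs f c -> 0 < r -> r < 1 ->
  sqint (fun t => f (r%:C * expit t) - h t)
  = sqint (fun t => peval c (r%:C * expit t) - h t).
Proof.
move=> fc r0 r1; congr sqint; apply/funext => t; rewrite (has_coefsE fc) //.
by rewrite Normc.normcM normc_expit mulr1 normc_real gtr0_norm.
Qed.

Lemma cmeasurable_dilate c (r : R) : square_summable c -> 0 < r -> r < 1 ->
  cmeasurable (fun t => peval c (r%:C * expit t)).
Proof.
move=> cs r0 r1; apply: (@cmeasurable_cvg (trigpoly (fun k => c k * r%:C ^+ k))).
  by move=> n; exact: cmeasurable_trigpoly.
move=> t _.
rewrite (_ : (fun n => _) = series (fun k => c k * (r%:C * expit t) ^+ k)).
  apply: cvg_peval_l2 => //.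
  by rewrite Normc.normcM normc_expit mulr1 normc_real gtr0_norm.
by apply/funext => n; apply: eq_bigr => k _; rewrite exprMn mulrA.
Qed.

Lemma sqint_opp h u : sqint (fun t => h t - u t) = sqint (fun t => u t - h t).
Proof. by congr (integral _ _ _); apply/funext => t; rewrite normc_distC. Qed.

Lemma sqint_triangle h u v (A B : R) : cmeasurable h -> cmeasurable u ->
  cmeasurable v ->
  (sqint (fun t => (h t - u t)%R) <= A%:E)%E ->
  (sqint (fun t => (u t - v t)%R) <= B%:E)%E ->
  (sqint (fun t => (h t - v t)%R) <= (2 * A + 2 * B)%:E)%E.
Proof.
move=> mh mu' mv hA hB.
rewrite (_ : (fun t => _) = (fun t => (h t - u t) + (u t - v t))).
  by apply: sqintD_le => //; exact: cmeasurableB.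
by apply/funext => t; rewrite subrKA.
Qed.

(** The dilates of [f] approach [F] as well as the partial sums. *)
Lemma boundary_value_approximates f c F : has_coefs f c ->
  is_boundary_value f F -> cmeasurable F /\ approximates c F.
Proof.
move=> fc [m1 m2 Fcvg]; have mF : cmeasurable F by [].
have [cs _] := fc; split => // e e0.
have e4 : 0 < e / 4 by rewrite divr_gt0.
have [N HN] := dilate_approx cs e4; exists N => m /HN Hm.
have /fine_cvgP[Ff /cvgrPdist_le/(_ _ e4) Fe] := Fcvg.
have [r [r0 r1 rf re rm]] : exists r : R, [/\ 0 < r, r < 1,
    sqint (fun t => f (r%:C * expit t) - F t) \is a fin_num,
    `|0 - fine (sqint (fun t => f (r%:C * expit t) - F t))| <= e / 4 &
    (sqint (fun t => (peval c (r%:C * expit t) - trigpoly c m t)%R) <= (e / 4)%:E)%E].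
  apply: (@filter_ex _ ((1 : R)^'-)); near=> r; split; near: r => //.
  - exact: nbhs_left_gt.
  - exact: nbhs_left_lt.
have -> : e = 2 * (e / 4) + 2 * (e / 4) by field.
apply: (@sqint_triangle _ (fun t => peval c (r%:C * expit t))) => //.
- exact: cmeasurable_dilate.
- exact: cmeasurable_trigpoly.
- rewrite sqint_opp -(dilate_sqint _ fc r0 r1) -(fineK rf) lee_fin.
  by apply: le_trans re; rewrite sub0r normrN ler_norm.
Unshelve. all: by end_near. Qed.

Lemma approximates_boundary_value f c F : has_coefs f c -> cmeasurable F ->
  approximates c F -> is_boundary_value f F.
Proof.
move=> fc mF cF; have [cs _] := fc; case: (mF) => m1 m2; split => //.
have H (e : R) : 0 < e -> \forall r \near (1 : R)^'-,
    (sqint (fun t => (f (r%:C * expit t) - F t)%R) <= e%:E)%E.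
  move=> e0; have e4 : 0 < e / 4 by rewrite divr_gt0.
  have [N HN] := dilate_approx cs e4; have [M HM] := cF _ e4.
  have H1 := HN (N + M)%N (leq_addr _ _); have H2 := HM (N + M)%N (leq_addl _ _).
  near=> r.
  have r0 : 0 < r by near: r; exact: nbhs_left_gt.
  have r1 : r < 1 by near: r; exact: nbhs_left_lt.
  have -> : e = 2 * (e / 4) + 2 * (e / 4) by field.
  rewrite (dilate_sqint _ fc r0 r1).
  apply: (@sqint_triangle _ (trigpoly c (N + M)%N)) => //.
  - exact: cmeasurable_dilate.
  - exact: cmeasurable_trigpoly.
  - by near: r.
  - by rewrite sqint_opp.
apply/fine_cvgP; split.
  apply: filterS (H 1 ltr01) => r Hr.
  by rewrite ge0_fin_numE ?sqint_ge0 // (le_lt_trans Hr) // ltry.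
apply/cvgrPdist_le => e e0; apply: filterS (H e e0) => r Hr.
rewrite sub0r normrN ger0_norm ?fine_ge0 ?sqint_ge0 //=.
rewrite -lee_fin fineK // ge0_fin_numE ?sqint_ge0 // (le_lt_trans Hr) // ltry.
Unshelve. all: by end_near. Qed.

Lemma boundary_valueP f c : has_coefs f c ->
  cmeasurable (boundary_value f) /\ approximates c (boundary_value f).
Proof.
move=> fc; apply: boundary_value_approximates (fc) _.
have [F mF cF] := riesz_fischer fc.1.
by apply: (@getPex _ [set F | is_boundary_value f F]); exists F;
  exact: approximates_boundary_value cF.
Qed.

(** A substitute for the Cauchy-Schwarz inequality: the weights [a] and [b] are
    free, so that a product of a small and of a bounded function can be
    balanced. *)
Lemma circle_integral_le h u v (a b A B : R) : 0 <= a -> 0 <= b ->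
  cmeasurable h -> cmeasurable u -> cmeasurable v ->
  (forall t, normc (h t) <= a * normc (u t) ^+ 2 + b * normc (v t) ^+ 2) ->
  (sqint u <= A%:E)%E -> (sqint v <= B%:E)%E ->
  cintegrable h /\ normc (circle_integral h) <= 2 * (a * A + b * B).
Proof.
move=> a0 b0 mh mu' mv huv uA vB.
pose w t := a * normc (u t) ^+ 2 + b * normc (v t) ^+ 2.
have w0 t : 0 <= w t by rewrite addr_ge0 // mulr_ge0 // sqr_ge0.
have mZ k (x : R) : cmeasurable k -> measurable_fun D (fun t => (x * normc (k t) ^+ 2)%:E).
  move=> mk; apply/measurable_EFinP/measurable_funM; first exact: measurable_cst.
  by apply/measurable_EFinP; exact: measurable_sqr_normc.
have iw : (\int[mu]_(t in D) (w t)%:E <= (a * A + b * B)%:E)%E.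
  under eq_integral do rewrite EFinD.
  rewrite ge0_integralD //; try exact: measurable_circle; try exact: mZ;
    try by move=> t _; rewrite lee_fin mulr_ge0 // sqr_ge0.
  rewrite EFinD; apply: leeD; under eq_integral do rewrite EFinM.
    rewrite ge0_integralZl_EFin //; try exact: measurable_circle;
      try exact: measurable_sqr_normc; try by move=> t _; rewrite lee_fin sqr_ge0.
    by rewrite EFinM; apply: lee_wpmul2l.
  rewrite ge0_integralZl_EFin //; try exact: measurable_circle;
    try exact: measurable_sqr_normc; try by move=> t _; rewrite lee_fin sqr_ge0.
  by rewrite EFinM; apply: lee_wpmul2l.
have intw : mu.-integrable D (EFin \o w).
  apply/integrableP; split.
    rewrite (_ : EFin \o w = (fun t => (a * normc (u t) ^+ 2)%:E)
                             \+ (fun t => (b * normc (v t) ^+ 2)%:E))%E.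
      by apply: emeasurable_funD; exact: mZ.
    by apply/funext => t /=; rewrite -EFinD.
  under eq_integral do rewrite /= ger0_norm //.
  by rewrite (le_lt_trans iw) // ltry.
have key (x : R -> R) : measurable_fun D x -> (forall t, `|x t| <= w t) ->
    mu.-integrable D (EFin \o x) /\ `|\int[mu]_(t in D) x t| <= a * A + b * B.
  move=> mx xw; have ix : mu.-integrable D (EFin \o x).
    apply: le_integrable intw; first exact: measurable_circle.
      exact/measurable_EFinP.
    by move=> t _ /=; rewrite lee_fin (ger0_norm (w0 t)).
  split => //.
  have H1 : `|\int[mu]_(t in D) x t| <= \int[mu]_(t in D) `|x t|.
    by apply: le_normr_Rintegral => //; exact: measurable_circle.
  apply: (le_trans H1).
  have inx : mu.-integrable D (EFin \o (fun t => `|x t|)).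
    by have := integrable_abse ix; apply: eq_integrable; [exact: measurable_circle|].
  have H2 : \int[mu]_(t in D) `|x t| <= \int[mu]_(t in D) w t.
    by apply: le_Rintegral => //; exact: measurable_circle.
  apply: (le_trans H2).
  rewrite /Rintegral -lee_fin fineK //.
  by apply: integrable_fin_num => //; exact: measurable_circle.
have [h1 h2] := mh.
have [|i1 b1] := key _ h1; first by move=> t; rewrite (le_trans (normc_Re_le _)).
have [|i2 b2] := key _ h2; first by move=> t; rewrite (le_trans (normc_Im_le _)).
split => //; apply: (le_trans (normc_le_ReIm _)).
by rewrite mulr_natl mulr2n; apply: lerD.
Qed.

Lemma approximates_sqint c F : square_summable c -> cmeasurable F ->
  approximates c F -> exists A : R, 0 <= A /\
  ((sqint F <= A%:E)%E /\ forall m, (sqint (trigpoly c m) <= A%:E)%E).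
Proof.
move=> cs mF cF; have p0 := pi2_gt0 R.
have [N /(_ N (leqnn _)) HN] := cF 1 ltr01.
have S0 := sqnorm_ge0 cs.
have P m : (sqint (trigpoly c m) <= (2 * pi * sqnorm c)%:E)%E.
  by rewrite trigpoly_sqint lee_fin ler_pM2l // sum_le_sqnorm.
have S1 : 0 <= 2 * pi * sqnorm c by rewrite mulr_ge0 // ltW.
exists (2 * 1 + 2 * (2 * pi * sqnorm c)); split; first by lra.
split => [|m].
  rewrite (_ : F = (fun t => (F t - trigpoly c N t) + trigpoly c N t)).
    apply: sqintD_le => //; last exact: cmeasurable_trigpoly.
    by apply: cmeasurableB => //; exact: cmeasurable_trigpoly.
  by apply/funext => t; rewrite subrK.
apply: (le_trans (P m)); rewrite lee_fin.
lra.
Qed.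

Lemma normcM_le_sqr (x y : C) (s : R) : 0 < s ->
  normc (x * y) <= s^-1 * normc x ^+ 2 + s * normc y ^+ 2.
Proof.
move=> s0; rewrite Normc.normcM -(ler_pM2l s0) mulrDr mulVKf ?gt_eqF //.
have := sqr_ge0 (normc x - s * normc y); have := normc_ge0 x; have := normc_ge0 y.
move=> y0 x0; have : 0 <= s * (normc x * normc y) by rewrite !mulr_ge0 // ltW.
nra.
Qed.

(** Parseval's identity in polarised form.  It is exact for the partial sums
    [P] and [Q]; passing to the boundary values [F] and [G] costs the integrals
    of [(F - P) G^*] and of [P (G - Q)^*], each with one small factor. *)
Lemma hardy2_dotE f g c d : has_coefs f c -> has_coefs g d ->
  series (fun k => c k * (d k)^*) @ \oo --> hardy2_dot f g.
Proof.
move=> fc gd; have [cs _] := fc; have [ds _] := gd.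
have [mF cF] := boundary_valueP fc; have [mG dG] := boundary_valueP gd.
rewrite /hardy2_dot; set F := boundary_value f in mF cF *.
set G := boundary_value g in mG dG *.
have p0 := pi2_gt0 R.
have E m : series (fun k => c k * (d k)^*) m
    = (2 * pi)^-1%:C * circle_integral (fun t => trigpoly c m t * (trigpoly d m t)^*).
  rewrite circle_integral_trigpoly mulrA -rmorphM mulVf ?gt_eqF // rmorph1 mul1r.
  by [].
rewrite (_ : series _ = (fun m => (2 * pi)^-1%:C
  * circle_integral (fun t => trigpoly c m t * (trigpoly d m t)^*))); last exact/funext.
apply: cvgM; first exact: cvg_cst.
apply/cvg_normcP/cvgrPdist_le => e e0.
have [A [A0 [FA PA]]] := approximates_sqint cs mF cF.
have [B [B0 [GB _]]] := approximates_sqint ds mG dG.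
(* The weight [s] makes the contribution of the bounded factors at most half
   of [e]; the mean-square errors are then taken small relative to [s]. *)
pose s : R := e / (4 * (A + B + 1)).
have AB : 0 < 4 * (A + B + 1) by rewrite mulr_gt0 // ltr_wpDl // addr_ge0.
have s0 : 0 < s by rewrite divr_gt0.
pose n : R := s * e / 8.
have n0 : 0 < n by rewrite !mulr_gt0 // invr_gt0.
have [N HN] := cF _ n0; have [M HM] := dG _ n0.
exists (N + M)%N => // m NMm.
have mP := cmeasurable_trigpoly c m; have mQ := cmeasurable_trigpoly d m.
have Fm := HN m (leq_trans (leq_addr _ _) NMm).
have Gm := HM m (leq_trans (leq_addl _ _) NMm).
rewrite sub0r normrN ger0_norm ?normc_ge0 // normc_distC.
set P := trigpoly c m in mP Fm *; set Q := trigpoly d m in mQ Gm *.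
have sV : 0 <= s^-1 by rewrite invr_ge0 ltW.
have [i1 b1] : cintegrable (fun t => (F t - P t) * (G t)^*) /\
    normc (circle_integral (fun t => (F t - P t) * (G t)^*)) <= 2 * (s^-1 * n + s * B).
  apply: (@circle_integral_le _ (fun t => F t - P t) G) => //; first exact: ltW.
  - by apply: cmeasurableM; [exact: cmeasurableB|exact: cmeasurable_conj].
  - exact: cmeasurableB.
  - by move=> t; have := normcM_le_sqr (F t - P t) ((G t)^*) s0; rewrite normc_conj.
have [i2 b2] : cintegrable (fun t => P t * (G t - Q t)^*) /\
    normc (circle_integral (fun t => P t * (G t - Q t)^*)) <= 2 * (s * A + s^-1 * n).
  apply: (@circle_integral_le _ P (fun t => G t - Q t)) => //; first exact: ltW.
  - by apply: cmeasurableM => //; apply: cmeasurable_conj; exact: cmeasurableB.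
  - exact: cmeasurableB.
  - move=> t; have := normcM_le_sqr ((G t - Q t)^*) (P t) s0.
    by rewrite normc_conj (mulrC (P t)) (addrC (s * _)).
  - exact: PA.
have i3 : cintegrable (fun t => P t * (Q t)^*).
  apply/ccontinuous_integrable/ccontinuousM; first exact: ccontinuous_trigpoly.
  exact/ccontinuous_conj/ccontinuous_trigpoly.
rewrite (_ : (fun t => F t * (G t)^*) = (fun t => (F t - P t) * (G t)^*
    + (P t * (G t - Q t)^* + P t * (Q t)^*))); last first.
  by apply/funext => t; rewrite rmorphB /=; ring.
rewrite circle_integralD //; last exact: cintegrableD.
rewrite circle_integralD // addrA addrK.
apply: (le_trans (le_normcD _ _)); apply: (le_trans (lerD b1 b2)).
have -> : s^-1 * n = e / 8 by rewrite /n; field; rewrite gt_eqF.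
have : s * (4 * (A + B + 1)) = e by rewrite /s divfK // gt_eqF.
nra.
Qed.

Lemma has_coefs_szego a : normc a < 1 -> has_coefs (szego a) (szego_coef a).
Proof.
move=> a1; have ss := square_summable_szego a1; split => // z /open_discE z1.
by rewrite -peval_szego //; exact: cvg_peval_l2.
Qed.

(** The coefficients of the kernel are the conjugates of the powers of [a], up
    to the normalisation, so that the pairing is the power series at [a]. *)
Lemma hardy2_dot_szego f c a : has_coefs f c -> normc a < 1 ->
  hardy2_dot f (szego a) = (Num.sqrt (1 - normc a ^+ 2))%:C * f a.
Proof.
move=> fc a1; have [cs _] := fc.
apply: (cvgC_unique (hardy2_dotE fc (has_coefs_szego a1))).
rewrite (has_coefsE fc a1).
rewrite (_ : series _ = (fun n => (Num.sqrt (1 - normc a ^+ 2))%:C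
  * series (fun k => c k * a ^+ k) n)).
  by apply: cvgM; [exact: cvg_cst|exact: cvg_peval_l2].
apply/funext => n; rewrite /series /= big_distrr /=; apply: eq_bigr => k _.
rewrite /szego_coef rmorphM rmorphXn /= conjCK.
have -> : ((Num.sqrt (1 - normc a ^+ 2))%:C)^* = (Num.sqrt (1 - normc a ^+ 2))%:C.
  by apply: complexP => //=; rewrite oppr0.
ring.
Qed.

End BoundaryValue.

(** * The double zero at a maximum *)

Section Remainder.
Variable R : realType.
Local Notation C := R[i].
Implicit Types (c d p : nat -> C) (a b z l u : C) (f g : C -> C).

(** After halving the variable, the difference of the two coefficient sequences
    becomes bounded, so that [coef_cvg0] applies to it as a constant
    sequence. *)
Lemma power_series_unique f c d :
  power_series_on_disc f c -> power_series_on_disc f d -> c = d.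
Proof.
move=> fc fd; pose h : C := (2^-1)%:C.
have hn : normc h = 2^-1 by rewrite normc_real gtr0_norm // invr_gt0.
have h0 : h != 0 by rewrite -normc_eq0 hn invr_neq0.
pose e k := (c k - d k) * h ^+ k.
have E z : normc z < 1 -> series (fun k => e k * z ^+ k) @ \oo --> (0 : C).
  move=> z1; have hz1 : open_disc (h * z).
    apply/open_discE; rewrite Normc.normcM hn.
    by have := normc_ge0 z; lra.
  rewrite -(subrr (f (h * z))).
  rewrite (_ : series _ = (fun n => series (fun k => c k * (h * z) ^+ k) n
     - series (fun k => d k * (h * z) ^+ k) n)).
    by apply: cvgB; [exact: fc|exact: fd].
  apply/funext => n; rewrite /series /= -sumrB; apply: eq_bigr => k _.
  by rewrite /e exprMn; ring.
have [M eM] : exists M, forall k, normc (e k) <= M.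
  have hh : normc h < 1 by rewrite hn; lra.
  have H1 : series (fun k => (c k - d k) * h ^+ k) @ \oo --> (0 : C).
    rewrite -(subrr (f h)).
    rewrite (_ : series _ = (fun n => series (fun k => c k * h ^+ k) n
       - series (fun k => d k * h ^+ k) n)).
      by apply: cvgB; [apply: fc|apply: fd]; exact/open_discE.
    apply/funext => n; rewrite /series /= -sumrB; apply: eq_bigr => k _.
    by rewrite mulrBl.
  have H2 : normc (e k) @[k --> \oo] --> normc (0 : C).
    by apply: cvg_normc; exact: cvg_series_cvg_0 (cvgP _ H1).
  have /cvg_seq_bounded/bounded_fun_has_ubound[M HM] := cvgP _ H2.
  by exists M => k; apply: HM; exists k.
have e0 k : e k = 0.
  have H : (fun _ : nat => e k) @ \oo --> (0 : C).
    apply: (@coef_cvg0 _ (fun _ => e) M) => // z z1.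
    by rewrite (peval_unique (E z z1)); exact: cvg_cst.
  by apply: (cvgC_unique _ H); exact: cvg_cst.
apply/funext => k; apply/eqP; rewrite -subr_eq0.
by have /eqP := e0 k; rewrite mulf_eq0 expf_eq0 (negbTE h0) andbF orbF.
Qed.

Lemma peval_inj c d : square_summable c -> square_summable d ->
  (forall z, normc z < 1 -> peval c z = peval d z) -> c = d.
Proof.
move=> cs ds E; apply: (@power_series_unique (peval c)) => z /open_discE z1.
  exact: cvg_peval_l2.
by rewrite E //; exact: cvg_peval_l2.
Qed.

Lemma cvg_normc_at a : normc z @[z --> a] --> normc a.
Proof. by apply: (@cvg_normc R C (nbhs a) _ id); exact: cvg_id. Qed.

Lemma open_disc_near a : normc a < 1 -> \forall z \near a, normc z < 1.
Proof.
move=> a1; exact: (cvgr_lt _ (@cvg_normc_at a) _ a1).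
Qed.

Lemma cvg_peval_at c a : square_summable c -> normc a < 1 ->
  peval c z @[z --> a] --> peval c a.
Proof.
move=> cs a1; apply/(@cvg_normcP R C (nbhs a) _).
pose B := Num.sqrt (sqnorm (diff_quot a c)).
have H : normc (z - a) * (B / ((1 - normc a) / 2)) @[z --> a] --> (0 : R).
  rewrite -[X in _ --> X](mul0r (B / ((1 - normc a) / 2))).
  apply: (@cvgM _ _ (nbhs a)); last exact: cvg_cst.
  by apply/(@cvg_normcP R C (nbhs a) _ id a); exact: cvg_id.
apply: (squeeze_cvgr _ (cvg_cst 0) H).
have a2 : normc a < (1 + normc a) / 2 by lra.
have Hn : \forall z \near nbhs a, normc z < (1 + normc a) / 2.
  exact: (cvgr_lt _ (@cvg_normc_at a) _ a2).
near=> z.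
have z2 : normc z < (1 + normc a) / 2 by near: z; exact: Hn.
have z1 : normc z < 1 by lra.
rewrite normc_ge0 /= (peval_diff_quot a1 cs z1) addrC addKr Normc.normcM.
rewrite ler_wpM2l ?normc_ge0 //.
have ds := square_summable_diff_quot a1 cs.
apply: (le_trans (normc_peval_le (fun k => normc_le_sqnorm k ds) z1)).
by rewrite -/B ler_wpM2l ?sqrtr_ge0 // lef_pV2 ?posrE; lra.
Unshelve. all: by end_near. Qed.

Lemma sqr_normc_line a u (t : R) :
  normc (a + t%:C * u) ^+ 2
  = normc a ^+ 2 + t * (2 * complex.Re (a^* * u) + t * normc u ^+ 2).
Proof. by rewrite !sqr_normcE; case: a u => [? ?] [? ?] /=; ring. Qed.

Lemma Re_conj_line (A u r : C) (t : R) :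
  complex.Re (A * (t%:C * u * r)^*) = t * complex.Re (A^* * u * r).
Proof. by case: A u r => [? ?] [? ?] [? ?] /=; ring. Qed.

Lemma Re_max_deriv (A u r a : C) (s : R) :
  2 * complex.Re (u * (A^* * (r * s%:C - A * a^*)))
  = complex.Re (A^* * u * r) * 2 * s - normc A ^+ 2 * (2 * complex.Re (a^* * u)).
Proof.
by rewrite !sqr_normcE; case: A u r a => [? ?] [? ?] [? ?] [? ?] /=; ring.
Qed.

(** First-order condition at a maximum of [|f z|^2 (1 - |z|^2)].  The derivative
    along every direction [u] is nonpositive; taking for [u] the conjugate of
    the complex derivative shows that the latter vanishes, unless [f] vanishes
    at the maximum and hence everywhere. *)
Lemma peval_max_deriv c a : square_summable c -> normc a < 1 ->
  (forall b, normc b < 1 ->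
     normc (peval c b) ^+ 2 * (1 - normc b ^+ 2)
     <= normc (peval c a) ^+ 2 * (1 - normc a ^+ 2)) ->
  peval (diff_quot a c) a * (1 - normc a ^+ 2)%:C = peval c a * a^*.
Proof.
move=> cs a1 cmax; set r := peval _ a; set A := peval c a.
have ds := square_summable_diff_quot a1 cs.
(* [A^* * X] is the derivative of [|f z|^2 (1 - |z|^2)] with respect to [z]. *)
pose X := r * (1 - normc a ^+ 2)%:C - A * a^*.
have key u : complex.Re (u * (A^* * X)) <= 0.
  have cb : a + t%:C * u @[t --> (0 : R)^'+] --> a.
    apply/cvg_normcP.
    rewrite (_ : (fun t => _) = (fun t : R => `|t| * normc u)); last first.
      by apply/funext => t; rewrite addrC addKr Normc.normcM normc_real.
    rewrite -[X in _ --> X](mul0r (normc u)).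
    apply: cvgM; last exact: cvg_cst.
    have : `|t| @[t --> (0 : R)^'+] --> `|0 : R|.
      by apply: cvg_at_right_filter; apply: norm_continuous.
    by rewrite normr0.
  pose rb t := peval (diff_quot a c) (a + t%:C * u).
  have crb : rb t @[t --> (0 : R)^'+] --> r.
    by apply: (cvg_comp _ _ cb); exact: cvg_peval_at.
  (* The difference of the values at [a + t u] and at [a], divided by [t], less
     a nonnegative term of second order. *)
  pose phi t := complex.Re (A^* * u * rb t) * 2 * (1 - normc (a + t%:C * u) ^+ 2)
    - normc A ^+ 2 * (2 * complex.Re (a^* * u) + t * normc u ^+ 2).
  have cphi : phi t @[t --> (0 : R)^'+] --> complex.Re (A^* * u * r) * 2 * (1 - normc a ^+ 2)
    - normc A ^+ 2 * (2 * complex.Re (a^* * u) + 0 * normc u ^+ 2).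
    have cn : normc (a + t%:C * u) @[t --> (0 : R)^'+] --> normc a.
      exact: (cvg_normc cb).
    have cn2 : normc (a + t%:C * u) ^+ 2 @[t --> (0 : R)^'+] --> normc a ^+ 2.
      exact: (cvgM cn cn).
    apply: cvgB.
      apply: cvgM.
        apply: cvgM; last exact: cvg_cst.
        by apply: cvg_Re; apply: cvgM; [exact: cvg_cst|exact: crb].
      by apply: cvgB; [exact: cvg_cst|exact: cn2].
    apply: cvgM; first exact: cvg_cst.
    apply: cvgD; first exact: cvg_cst.
    apply: cvgM; last exact: cvg_cst.
    by apply: cvg_at_right_filter; exact: cvg_id.
  have phi0 : \forall t \near (0 : R)^'+, phi t <= 0.
    have cbn : normc (a + t%:C * u) @[t --> (0 : R)^'+] --> normc a.
      exact: (cvg_normc cb).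
    have Hb : \forall t \near (0 : R)^'+, normc (a + t%:C * u) < 1.
      exact: (cvgr_lt _ cbn _ a1).
    near=> t; have t0 : 0 < t by near: t; exact: nbhs_right_gt.
    have b1 : normc (a + t%:C * u) < 1 by near: t.
    have := cmax _ b1; rewrite (peval_diff_quot a1 cs b1) -/(rb t) -/A.
    rewrite (addrC a) addrK (addrC _ a) sqr_normcD.
    rewrite /phi; set nb := normc (a + t%:C * u) ^+ 2.
    have nbE : nb = normc a ^+ 2 + t * (2 * complex.Re (a^* * u) + t * normc u ^+ 2).
      exact: sqr_normc_line.
    rewrite Re_conj_line.
    have nb1 : 0 <= 1 - nb by rewrite subr_ge0 expr_le1 ?normc_ge0 // ltW.
    have := sqr_ge0 (normc (t%:C * u * rb t)).
    set Y := _ ^+ 2; set W := complex.Re _; set A2 := normc A ^+ 2.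
    set V := 2 * complex.Re _ + _ in nbE *.
    move=> Y0 H; rewrite -(pmulr_rle0 _ t0).
    have : 0 <= Y * (1 - nb) by rewrite mulr_ge0.
    move: H; rewrite nbE.
    nra.
  have : complex.Re (A^* * u * r) * 2 * (1 - normc a ^+ 2)
      - normc A ^+ 2 * (2 * complex.Re (a^* * u) + 0 * normc u ^+ 2) <= 0.
    exact: (cvgr_to_le cphi phi0).
  by rewrite mul0r addr0 -Re_max_deriv pmulr_rle0.
have A0 : A^* * X = 0.
  have := key ((A^* * X)^*); rewrite mulrC.
  have -> : complex.Re (A^* * X * (A^* * X)^*) = normc (A^* * X) ^+ 2.
    by rewrite sqr_normcE; case: (A^* * X) => ? ? /=; ring.
  move=> H; have /eqP : normc (A^* * X) ^+ 2 = 0 by apply/eqP; rewrite eq_le H sqr_ge0.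
  by rewrite sqrf_eq0 normc_eq0 => /eqP.
have [Az|An] := eqVneq A 0; last first.
  have /eqP := A0; rewrite mulf_eq0 conjC_eq0 (negbTE An) /= /X subr_eq0.
  by move=> /eqP.
have c0 b : normc b < 1 -> peval c b = 0.
  move=> b1; have := cmax b b1; rewrite -/A Az normc0 expr0n mul0r.
  rewrite pmulr_lle0 ?subr_gt0 ?expr_lt1 ?normc_ge0 // => H.
  have /eqP : normc (peval c b) ^+ 2 = 0 by apply/eqP; rewrite eq_le H sqr_ge0.
  by rewrite sqrf_eq0 normc_eq0 => /eqP.
have cz : c = fun _ => 0.
  apply: peval_inj => //; first exact: square_summable0.
  move=> z z1; rewrite c0 //; apply/esym/peval_unique.
  rewrite (_ : series _ = fun _ => 0); first exact: cvg_cst.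
  by apply/funext => n; rewrite /series /= big1 // => k _; rewrite mul0r.
have p0 : peval (fun _ : nat => 0 : C) a = 0 by rewrite -cz c0.
rewrite Az mul0r /r; have -> : diff_quot a c = fun _ => 0.
  by apply/funext => n; rewrite /diff_quot cz p0.
by rewrite p0 mul0r.
Unshelve. all: by end_near. Qed.


(** The quotient by the Moebius factor of [a] of a function vanishing at [a]. *)
Definition mobius_div a (g : nat -> C) k : C :=
  diff_quot a g k + - a^* * rshift (diff_quot a g) k.

Lemma square_summable_mobius_div a (g : nat -> C) : normc a < 1 -> square_summable g ->
  square_summable (mobius_div a g).
Proof.
move=> a1 gs; have ds := square_summable_diff_quot a1 gs.
by apply: square_summableD => //; apply: square_summableZ; exact: square_summable_rshift.
Qed.

Lemma peval_mobius_div_diff a (g : nat -> C) z : normc a < 1 -> square_summable g ->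
  normc z < 1 ->
  peval (mobius_div a g) z = (1 - a^* * z) * peval (diff_quot a g) z.
Proof.
move=> a1 gs z1; have ds := square_summable_diff_quot a1 gs.
have rs := square_summable_rshift ds.
rewrite /mobius_div pevalD_l2 ?pevalZ_l2 ?peval_rshift //.
  by ring.
exact: square_summableZ.
Qed.

Lemma peval_mobius_div a (g : nat -> C) z : normc a < 1 -> square_summable g ->
  normc z < 1 -> peval g a = 0 ->
  mobius a z * peval (mobius_div a g) z = peval g z.
Proof.
move=> a1 gs z1 ga; rewrite peval_mobius_div_diff // (peval_diff_quot a1 gs z1) ga.
by rewrite /mobius mulrA divfK ?denom_neq0 // add0r.
Qed.

Lemma mobius_neq0 a z : normc a < 1 -> normc z < 1 -> z != a -> mobius a z != 0.
Proof.
by move=> a1 z1 za; rewrite mulf_neq0 ?subr_eq0 // invr_neq0 // denom_neq0.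
Qed.

Lemma mobius_self a : mobius a a = 0.
Proof. by rewrite /mobius subrr mul0r. Qed.

Lemma normc_mobius_le a z : normc a < 1 -> normc z < 1 -> normc (mobius a z) <= 1.
Proof.
move=> a1 z1; rewrite Normc.normcM Normc.normcV.
have d0 : 0 < normc (1 - a^* * z).
  by rewrite lt_neqAle normc_ge0 eq_sym normc_eq0 denom_neq0.
rewrite ler_pdivrMr // mul1r -(ler_pXn2r (n := 2)) ?nnegrE ?normc_ge0 //.
have := sqr_normc_mobius a z 1; rewrite mulr1 => ->.
rewrite Normc.normc1 expr1n gerBl mulr_ge0 // subr_ge0 expr_le1 ?normc_ge0 // ltW //.
Qed.

Lemma szego_scale_sqrC a : normc a < 1 ->
  (Num.sqrt (1 - normc a ^+ 2))%:C * (Num.sqrt (1 - normc a ^+ 2))%:C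
  = 1 - a^* * a.
Proof.
move=> a1; rewrite -rmorphM -expr2 szego_scale_sqr // sqr_normcE.
by case: a {a1} => x y; apply: complexP => /=; ring.
Qed.

Lemma szego_self a : normc a < 1 ->
  (Num.sqrt (1 - normc a ^+ 2))%:C * szego a a = 1.
Proof.
by move=> a1; rewrite /szego mulrA szego_scale_sqrC // mulfV // denom_neq0.
Qed.

Lemma le_normc (x y : C) : `|x| <= `|y| -> normc x <= normc y.
Proof. by rewrite (norm_normc x) (norm_normc y) lecR. Qed.

Lemma maximal_peval f c a : has_coefs f c -> maximal_selection f a ->
  normc a < 1 /\ forall b, normc b < 1 ->
     normc (peval c b) ^+ 2 * (1 - normc b ^+ 2)
     <= normc (peval c a) ^+ 2 * (1 - normc a ^+ 2).
Proof.
move=> fc [/open_discE a1 H]; split => // b b1.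
have /le_normc : `|hardy2_dot f (szego b)| <= `|hardy2_dot f (szego a)|.
  by apply: H; exact/open_discE.
rewrite !(hardy2_dot_szego fc) // !Normc.normcM !normc_real.
have n0 x : `|Num.sqrt (1 - normc x ^+ 2)| * normc (f x) \is Num.nneg.
  by rewrite nnegrE mulr_ge0 // normc_ge0.
move=> /(lerXn2r 2 (n0 b) (n0 a)).
rewrite !exprMn !real_normK ?num_real // !szego_scale_sqr //.
by rewrite !(has_coefsE fc) // mulrC (mulrC (_ - _)).
Qed.

(** Subtracting the kernel term leaves a double zero at [a]: the value is
    cancelled by the reproducing property, and the derivative by the
    first-order condition at the maximum. *)
Lemma next_remainderP f c a : has_coefs f c -> maximal_selection f a ->
  exists2 c', has_coefs (next_remainder f a) c' &
  c = (fun k => hardy2_dot f (szego a) * szego_coef a k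
                + mobius_mul a (mobius_mul a c') k).
Proof.
move=> fc fa; have [cs _] := fc; have [a1 cmax] := maximal_peval fc fa.
have ss := square_summable_szego a1.
set l := hardy2_dot f (szego a).
have lE : l = (Num.sqrt (1 - normc a ^+ 2))%:C * peval c a.
  by rewrite /l (hardy2_dot_szego fc) // (has_coefsE fc).
pose g k := c k + - l * szego_coef a k.
have gs : square_summable g by apply: square_summableD => //; exact: square_summableZ.
have gE z : normc z < 1 -> peval g z = peval c z - l * szego a z.
  move=> z1; rewrite /g pevalD_l2 // ?(pevalZ_l2 _ ss z1) ?peval_szego ?mulNr //.
  exact: square_summableZ.
have ga : peval g a = 0.
  by rewrite gE // lE mulrAC szego_self // mul1r subrr.
have dgs := square_summable_diff_quot a1 gs.
have dcs := square_summable_diff_quot a1 cs.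
(* The derivative of [g] at [a], as a limit of difference quotients. *)
have q0 : peval (diff_quot a g) a = 0.
  have cden : (1 - a^* * z) @[z --> a] --> 1 - a^* * a.
    apply: (@cvgB _ _ _ (nbhs a)); first exact: cvg_cst.
    by apply: (@cvgM _ _ (nbhs a)); [exact: cvg_cst|exact: cvg_id].
  have E : peval (diff_quot a c) z - peval c a * a^* / (1 - a^* * z) @[z --> a^'] --> (0 : C).
    have -> : 0 = peval (diff_quot a c) a - peval c a * a^* / (1 - a^* * a).
      rewrite -(peval_max_deriv cs a1 cmax).
      have -> : (1 - normc a ^+ 2)%:C = 1 - a^* * a.
        by rewrite sqr_normcE; case: (a) => x y; apply: complexP => /=; ring.
      by rewrite mulfK ?subrr // denom_neq0.
    apply: cvg_within_filter; apply: (@cvgB _ _ _ (nbhs a)); first exact: cvg_peval_at.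
    apply: (@cvgM _ _ (nbhs a)); first exact: cvg_cst.
    by apply: cvgV => //; exact: denom_neq0.
  have G : peval (diff_quot a g) z @[z --> a^'] --> peval (diff_quot a g) a.
    by apply: cvg_within_filter; exact: cvg_peval_at.
  apply: (cvgC_unique G); apply: cvg_trans E; apply: near_eq_cvg.
  near=> z.
  have z1 : normc z < 1 by near: z; apply: nbhs_dnbhs; exact: open_disc_near.
  have za : z != a by near: z; exact: nbhs_dnbhs_neq.
  have zan : z - a != 0 by rewrite subr_eq0.
  apply: (mulfI zan).
  have := peval_diff_quot a1 gs z1; rewrite ga add0r => <-.
  rewrite gE // mulrBr.
  have := peval_diff_quot a1 cs z1 => /eqP; rewrite addrC -subr_eq => /eqP <-.
  have d0 := denom_neq0 a1 z1.
  have d1 := denom_neq0 a1 a1.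
  have : l * szego a z = peval c a * (1 - a^* * a) / (1 - a^* * z).
    rewrite lE /szego -(szego_scale_sqrC a1); ring.
  move=> ->; field; exact: d0.
pose q := mobius_div a g.
have qs : square_summable q by exact: square_summable_mobius_div.
have qa : peval q a = 0 by rewrite /q peval_mobius_div_diff // q0 mulr0.
pose c' := mobius_div a q.
have cs' : square_summable c' by exact: square_summable_mobius_div.
have E z : normc z < 1 -> mobius a z ^+ 2 * peval c' z = peval c z - l * szego a z.
  by move=> z1; rewrite expr2 -mulrA !peval_mobius_div // gE.
exists c'.
  have red z : normc z < 1 -> z != a -> double_reduction f a z = peval c' z.
    move=> z1 za; rewrite /double_reduction (has_coefsE fc) // -E //.
    by rewrite mulrC mulKf // expf_neq0 // mobius_neq0.
  split => // z /open_discE z1.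
  rewrite /next_remainder; case: eqVneq => [->|za]; last first.
    by rewrite red //; exact: cvg_peval_l2.
  rewrite (_ : lim _ = peval c' a); first exact: cvg_peval_l2.
  apply: cvg_lim; first exact: norm_hausdorff.
  have : peval c' w @[w --> a^'] --> peval c' a.
    by apply: cvg_within_filter; exact: cvg_peval_at.
  apply: cvg_trans; apply: near_eq_cvg; near=> w; apply/esym/red.
    by near: w; apply: nbhs_dnbhs; exact: open_disc_near.
  by near: w; exact: nbhs_dnbhs_neq.
have ms := square_summable_mobius_mul a1 cs'.
apply: peval_inj => //.
  apply: square_summableD; first exact: square_summableZ.
  exact: square_summable_mobius_mul.
move=> z z1; rewrite pevalD_l2 // ?(pevalZ_l2 _ ss z1) ?peval_szego //.
- by rewrite !peval_mobius_mul // mulrA -expr2 E // addrC subrK.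
- exact: square_summableZ.
- exact: square_summable_mobius_mul.
Unshelve. all: by end_near. Qed.

End Remainder.

(** * The expansion and its error *)

Section Expansion.
Variable R : realType.
Local Notation C := R[i].
Implicit Types (c d p q : nat -> C) (f g : C -> C) (z : C).

Lemma hardy2_normE f c : has_coefs f c -> hardy2_norm f = Num.sqrt (sqnorm c).
Proof.
move=> [cs fc]; rewrite /hardy2_norm.
have -> : taylor_coefs f = c.
  apply: (power_series_unique _ fc).
  by apply: (@getPex _ [set d | power_series_on_disc f d]); exists c.
by rewrite nneseries_sqnorm.
Qed.

Variables (a l : nat -> C).
Hypothesis a1 : forall k, normc (a k) < 1.

(** The Taylor coefficients of the partial expansion with terms [n] to
    [n + j - 1], divided by the squared Moebius factors before [n].  The
    recursion peels off the first term, which is the one orthogonal to the rest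
    by [sqnorm_szegoD]. *)
Fixpoint partial_expansion j n : nat -> C :=
  if j is j'.+1 then
    fun k => l n * szego_coef (a n) k
             + mobius_mul (a n) (mobius_mul (a n) (partial_expansion j' n.+1)) k
  else fun _ => 0.

(** The Taylor coefficients of the product of [q] with the squared Moebius
    factors from [n] to [n + j - 1]. *)
Fixpoint blaschke_mul j n q : nat -> C :=
  if j is j'.+1 then mobius_mul (a n) (mobius_mul (a n) (blaschke_mul j' n.+1 q))
  else q.

Lemma square_summable_mobius_sqr n q : square_summable q ->
  square_summable (mobius_mul (a n) (mobius_mul (a n) q)).
Proof. by move=> qs; do 2![apply: square_summable_mobius_mul => //]. Qed.

Lemma peval_mobius_sqr n q z : square_summable q -> normc z < 1 ->
  peval (mobius_mul (a n) (mobius_mul (a n) q)) z = mobius (a n) z ^+ 2 * peval q z.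
Proof.
move=> qs z1; rewrite !peval_mobius_mul //; last exact: square_summable_mobius_mul.
by rewrite mulrA.
Qed.

Lemma peval_szego_mobius_sqr n q z : square_summable q -> normc z < 1 ->
  peval (fun k => l n * szego_coef (a n) k
                  + mobius_mul (a n) (mobius_mul (a n) q) k) z
  = l n * szego (a n) z + mobius (a n) z ^+ 2 * peval q z.
Proof.
move=> qs z1; have ss := square_summable_szego (a1 n).
rewrite pevalD_l2 ?peval_mobius_sqr // ?(pevalZ_l2 _ ss z1) ?peval_szego //.
  exact: square_summableZ.
exact: square_summable_mobius_sqr.
Qed.

Lemma sqnorm_mobius_sqr n q : square_summable q ->
  sqnorm (mobius_mul (a n) (mobius_mul (a n) q)) = sqnorm q.
Proof.
by move=> qs; rewrite !sqnorm_mobius_mul //; exact: square_summable_mobius_mul.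
Qed.

Lemma square_summable_partial j n : square_summable (partial_expansion j n).
Proof.
elim: j n => [|j IH] n; first exact: square_summable0.
apply: square_summableD; last exact: square_summable_mobius_sqr.
exact/square_summableZ/square_summable_szego.
Qed.

Lemma square_summable_blaschke j n q : square_summable q ->
  square_summable (blaschke_mul j n q).
Proof.
by move=> qs; elim: j n => [|j IH] n //; exact: square_summable_mobius_sqr.
Qed.

Lemma sqnorm_blaschke j n q : square_summable q ->
  sqnorm (blaschke_mul j n q) = sqnorm q.
Proof.
move=> qs; elim: j n => [|j IH] n //=.
by rewrite sqnorm_mobius_sqr ?IH //; exact: square_summable_blaschke.
Qed.

Lemma sqnorm_szego_mobius_sqr n q : square_summable q ->
  sqnorm (fun k => l n * szego_coef (a n) k
                   + mobius_mul (a n) (mobius_mul (a n) q) k)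
  = normc (l n) ^+ 2 + sqnorm q.
Proof.
move=> qs; rewrite sqnorm_szegoD ?sqnorm_mobius_sqr //.
  exact: square_summable_mobius_sqr.
by rewrite peval_mobius_sqr // mobius_self expr0n mul0r.
Qed.

Lemma sqnorm_partial j n :
  sqnorm (partial_expansion j n) = \sum_(n <= i < n + j) normc (l i) ^+ 2.
Proof.
elim: j n => [|j IH] n /=; first by rewrite addn0 big_geq // sqnorm0.
rewrite sqnorm_szego_mobius_sqr ?IH; last exact: square_summable_partial.
by rewrite addSnnS [RHS]big_ltn // addnS ltnS leq_addr.
Qed.

Lemma peval_partial j n z : normc z < 1 ->
  peval (partial_expansion j n) z
  = \sum_(n <= k < n + j) l k * (szego (a k) z * \prod_(n <= i < k) mobius (a i) z ^+ 2).
Proof.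
move=> z1; elim: j n => [|j IH] n /=.
  rewrite addn0 big_geq //; apply: peval_unique.
  rewrite (_ : series _ = fun _ => 0); first exact: cvg_cst.
  by apply/funext => m; rewrite /series /= big1 // => k _; rewrite mul0r.
have ps := square_summable_partial j n.+1.
rewrite peval_szego_mobius_sqr // IH addSnnS.
rewrite [RHS]big_ltn; last by rewrite addnS ltnS leq_addr.
rewrite (big_geq (leqnn n)) mulr1; congr (_ + _).
rewrite big_distrr /= !big_nat; apply: eq_bigr => k /andP[nk _].
by rewrite [in RHS]big_ltn //; ring.
Qed.

Lemma partial_blaschke (co : nat -> nat -> C) :
  (forall n, square_summable (co n)) ->
  (forall n, co n = (fun k => l n * szego_coef (a n) k
     + mobius_mul (a n) (mobius_mul (a n) (co n.+1)) k)) ->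
  forall j n, co n = (fun k => partial_expansion j n k + blaschke_mul j n (co (n + j)%N) k).
Proof.
move=> cs cE j n; have ps := square_summable_partial.
have bs j' n' := @square_summable_blaschke j' n' _ (cs (n' + j')%N).
apply: peval_inj => // [|z z1]; first exact: square_summableD.
rewrite pevalD_l2 //; elim: j n => [|j IH] n /=.
  rewrite addn0 (_ : peval (fun=> 0) z = 0) ?add0r //.
  by rewrite (peval_partial 0 n z1) addn0 big_geq.
have bs' := square_summable_blaschke j n.+1 (cs (n + j.+1)%N).
rewrite {1}cE !peval_szego_mobius_sqr // peval_mobius_sqr //.
by rewrite -addrA -mulrDr -addSnnS -IH.
Qed.

Lemma normc_peval_blaschke j n q z : square_summable q -> normc z < 1 ->
  normc (peval (blaschke_mul j n q) z) <= normc (peval q z).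
Proof.
move=> qs z1; elim: j n => [|j IH] n //=.
rewrite peval_mobius_sqr //; last exact: square_summable_blaschke.
rewrite Normc.normcM normcX; apply: le_trans (IH n.+1).
rewrite ler_piMl ?normc_ge0 // exprn_ile1 ?normc_ge0 //; exact: normc_mobius_le.
Qed.

End Expansion.

Theorem theorem1 (R : realType) (f : R[i] -> R[i]) (a : nat -> R[i])
  (hf : hardy2 f)
  (ha : forall k, maximal_selection (double_remainder f a k) (a k)) :
  hardy2_cvg
    (fun n z => \sum_(0 <= k < n)
       hardy2_dot (double_remainder f a k) (szego (a k)) * double_TM a k z)
    f.
Proof.
have [c0 cs0 fc0] := hf.
have co_ex k : exists c, has_coefs (double_remainder f a k) c.
  elim: k => [|k [c Hc]]; first by exists c0.
  by have [c' Hc' _] := next_remainderP Hc (ha k); exists c'.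
have [co Hco] := choice co_ex.
pose l k := hardy2_dot (double_remainder f a k) (szego (a k)).
have cs k : square_summable (co k) := (Hco k).1.
have a1 k : normc (a k) < 1 := (maximal_peval (Hco k) (ha k)).1.
have coE k : co k = (fun i => l k * szego_coef (a k) i
    + mobius_mul (a k) (mobius_mul (a k) (co k.+1)) i).
  have [c' Hc' E] := next_remainderP (Hco k) (ha k).
  by rewrite (power_series_unique (Hco k.+1).2 Hc'.2).
have lE k : normc (l k) ^+ 2 = normc (peval (co k) (a k)) ^+ 2 * (1 - normc (a k) ^+ 2).
  rewrite /l (hardy2_dot_szego (Hco k)) // (has_coefsE (Hco k)) //.
  by rewrite Normc.normcM normc_real exprMn real_normK ?num_real // szego_scale_sqr // mulrC.
(* [T m] is the partial expansion and [h m] its error. *)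
pose T m := partial_expansion a l m 0.
pose h m := blaschke_mul a m 0 (co m).
have Ts m : square_summable (T m) by exact: square_summable_partial.
have hs m : square_summable (h m) by exact: square_summable_blaschke.
have co0 m k : co 0%N k = T m k + h m k.
  by rewrite [LHS](congr1 (@^~ k) (partial_blaschke a1 cs coE m 0)) add0n.
pose S m := \sum_(0 <= i < m) normc (l i) ^+ 2.
have SE m : sqnorm (co 0%N) = S m + sqnorm (co m).
  elim: m => [|m IH]; first by rewrite /S big_geq // add0r.
  by rewrite IH /S big_nat_recr //= {1}coE sqnorm_szego_mobius_sqr // addrA.
have S_le m : S m <= sqnorm (co 0%N) by rewrite (SE m) lerDl sqnorm_ge0.
have cS : cvgn S.
  apply: nondecreasing_is_cvgn; last by exists (sqnorm (co 0%N)) => _ [m _ <-].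
  by apply: nondecreasing_series => i _ _; exact: sqr_ge0.
have l0 : normc (l k) ^+ 2 @[k --> \oo] --> (0 : R) by exact: cvg_series_cvg_0.
(* Maximality bounds the values of the [m]-th remainder at [z] by [l m], up to
   a factor depending on [z] only. *)
have h0 z : normc z < 1 -> peval (h m) z @[m --> \oo] --> (0 : R[i]).
  move=> z1; have z2 : 0 < 1 - normc z ^+ 2 by rewrite subr_gt0 expr_lt1 ?normc_ge0.
  apply/cvg_normcP.
  have H : normc (peval (h m) z) ^+ 2 @[m --> \oo] --> (0 : R).
    have H1 : normc (l m) ^+ 2 * (1 - normc z ^+ 2)^-1 @[m --> \oo] --> (0 : R).
      rewrite -[X in _ --> X](mul0r (1 - normc z ^+ 2)^-1).
      by apply: cvgM; [exact: l0|exact: cvg_cst].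
    apply: (squeeze_cvgr _ (cvg_cst 0) H1); apply: nearW => m.
    rewrite sqr_ge0 /= ler_pdivlMr // lE.
    apply: le_trans ((maximal_peval (Hco m) (ha m)).2 z z1).
    apply: ler_wpM2r; first exact: ltW.
    rewrite ler_pXn2r ?nnegrE ?normc_ge0 //; exact: normc_peval_blaschke.
  rewrite (_ : (fun m => _) = Num.sqrt \o (fun m => normc (peval (h m) z) ^+ 2)).
    by rewrite -[X in _ --> X]sqrtr0; exact: (cvg_comp _ _ H (@sqrt_continuous R 0)).
  by apply/funext => m; rewrite subr0 /comp sqrtr_sqr ger0_norm ?normc_ge0.
have hk k : h m k @[m --> \oo] --> (0 : R[i]).
  apply: (@coef_cvg0 _ _ (Num.sqrt (sqnorm (co 0%N)))) => [m i|z z1]; last exact: h0.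
  apply: (le_trans (normc_le_sqnorm i (hs m))).
  rewrite /h sqnorm_blaschke // ler_wsqrtr // (SE m) lerDr.
  by apply: sumr_ge0 => j _; exact: sqr_ge0.
(* Fatou's lemma for sums: finitely many coefficients of [f] are limits of those
   of the [T m], whose norms are the partial sums [S m]. *)
have norm0 : sqnorm (co 0%N) <= limn S.
  apply: sqnorm_le => n.
  have TN : \sum_(0 <= k < n) normc (T m k) ^+ 2 @[m --> \oo]
      --> \sum_(0 <= k < n) normc (co 0%N k) ^+ 2.
    apply: cvg_sum_nat => k; rewrite (_ : (fun m => _) = (fun m => normc (co 0%N k - h m k) ^+ 2)).
      have Hk : normc (co 0%N k - h m k) @[m --> \oo] --> normc (co 0%N k).
        apply: cvg_normc; rewrite -[X in _ --> X]subr0.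
        by apply: cvgB; [exact: cvg_cst|exact: hk].
      exact: (cvgM Hk Hk).
    by apply/funext => m; rewrite (co0 m) addrK.
  apply: (cvgr_to_le TN); apply: nearW => m.
  apply: le_trans (sum_le_sqnorm n (Ts m)) _.
  rewrite sqnorm_partial // add0n.
  by apply: nondecreasing_cvgn_le => //; apply: nondecreasing_series => i _ _; exact: sqr_ge0.
have sq0 : sqnorm (co m) @[m --> \oo] --> (0 : R).
  have H1 : limn S - S m @[m --> \oo] --> (0 : R).
    by rewrite -(subrr (limn S)); apply: cvgB; [exact: cvg_cst|exact: cS].
  apply: (squeeze_cvgr _ (cvg_cst 0) H1); apply: nearW => m.
  by rewrite sqnorm_ge0 //= lerBrDl -SE.
have Hh n : has_coefs (fun z => f z - \sum_(0 <= k < n) l k * double_TM a k z) (h n).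
  split; first exact: hs.
  move=> z /open_discE z1.
  rewrite (_ : f z - _ = peval (h n) z); first exact: cvg_peval_l2.
  have -> : f z = peval (co 0%N) z := has_coefsE (Hco 0%N) z1.
  rewrite (funext (co0 n) : co 0%N = _) pevalD_l2 //.
  by rewrite (peval_partial l a1 n 0 z1) add0n addrAC subrr add0r.
split => [n|]; first by exists (h n); [exact: hs|exact: (Hh n).2].
under eq_fun do rewrite (hardy2_normE (Hh _)) /h sqnorm_blaschke //.
by have := cvg_comp _ _ sq0 (@sqrt_continuous R 0); rewrite sqrtr0.
Qed.
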